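(* Let $p$ be a prime number or zero and let $(F,K;\chi)$ be a model of $\mathrm{ACFC}_p$. If $X\subseteq K^n$ and $X'\subseteq K^{n'}$ are definable, $\mathrm{gr}(X)=\omega\cdot\rho_K+\rho_F$ and $\mathrm{gr}(X')=\omega\cdot\rho'_K+\rho'_F$ with $\rho_K,\rho_F,\rho'_K,\rho'_F\in\mathbb{N}$, then $$\mathrm{gr}(X\times X')=\omega\cdot(\rho_K+\rho'_K)+\rho_F+\rho'_F.$$
   Context: A character $\chi:F\to K$ between integral domains is a map with $\chi(ab)=\chi(a)\chi(b)$ for all $a,b\in F$, $\chi(0)=0$ and $\chi(1)=1$. A structure $(F,K;\chi)$ of this kind is a structure in the $2$-sorted language $L$, which consists of two disjoint copies of the language of rings (one for each sort) augmented by a unary function symbol $\chi$ from the first sort to the second. For $n\ge 1$, $\alpha\in F^n$ and $k\in\mathbb{N}^n$ put $\alpha^k=\alpha_1^{k_1}\cdots\alpha_n^{k_n}$. The tuple $\alpha$ is multiplicatively dependent if $\alpha^k=\alpha^l$ for some distinct $k,l\in\mathbb{N}^n$, and multiplicatively independent otherwise. A character $\chi:F\to K$ is generic if it is injective and, for every $n\ge1$ and every multiplicatively independent $\alpha\in F^n$, the tuple $\chi(\alpha)=(\chi(\alpha_1),\dots,\chi(\alpha_n))$ is algebraically independent, in the fraction field of $K$, over its prime field. $\mathrm{ACFC}$ is a recursive set of $\forall\exists$-sentences of $L$ whose models are exactly the structures $(F,K;\chi)$ with $F,K$ algebraically closed fields, $\mathrm{char}(K)=0$ and $\chi$ a generic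 character. For $p$ prime or zero, $\mathrm{ACFC}_p$ is $\mathrm{ACFC}$ together with sentences expressing $\mathrm{char}(F)=p$. Geometric rank. In the fixed model $(F,K;\chi)$, definable means definable in the $L$-structure with parameters. A family $(X_b)_{b\in Y}$ of subsets of $K^n$ is definable if both $Y$ and $\{(a,b)\in K^n\times Y:a\in X_b\}$ are definable. For a set definable in the field $K$ (resp. $F$) write $\mathrm{r}_K,\mathrm{d}_K$ (resp. $\mathrm{r}_F,\mathrm{d}_F$) for its Morley rank and Morley degree in the pure algebraically closed field $K$ (resp. $F$). $K$-algebraic sets are Zariski closed subsets of $K^n$. A set $S\subseteq K^n$ is algebraically presentable if $S=\bigcup_{\alpha\in D}V_\alpha$ for some definable $D\subseteq F^k$ and definable family $(V_\alpha)_{\alpha\in D}$ of $K$-algebraic sets. A pc-set is a set $T=V\setminus S\subseteq K^n$ with $V$ $K$-algebraic and $S$ algebraically presentable; $\mathrm{r}_K(T)$ and $\mathrm{d}_K(T)$ are defined as $\mathrm{r}_K$ and $\mathrm{d}_K$ of the Zariski closure of $T$. For pc-sets $T,T'\subseteq K^n$: $T\mathrel{\sim}T'$ (almost equal) means $\mathrm{r}_K(T)=\mathrm{r}_K(T')=\mathrm{r}_K(T\cap T')$ and $\mathrm{d}_K(T)=\mathrm{d}_K(T')=\mathrm{d}_K(T\cap T')$; $T,T'$ are almost disjoint if $\mathrm{r}_K(T)=\mathrm{r}_K(T')$ and $\mathrm{r}_K(T\cap T')<\mathrm{r}_K(T)$. A pc-presentation of $X\subseteq K^n$ is a definable family $(T_\alpha)_{\alpha\in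 D}$ of pc-sets with $D\subseteq F^k$ for some $k$ and $X=\bigcup_{\alpha\in D}T_\alpha$. Its primary index set $\hat D$ is the set of $\alpha\in D$ with $\mathrm{r}_K(T_\alpha)=\max_{\beta\in D}\mathrm{r}_K(T_\beta)$. It is essentially disjoint if for all $\alpha,\beta\in\hat D$, either $T_\alpha\sim T_\beta$ or $T_\alpha,T_\beta$ are almost disjoint. A primary index quotient of an essentially disjoint pc-presentation is a definable set $\widetilde D\subseteq F^l$ (some $l$) with a definable surjection $\hat D\to\widetilde D$, $\alpha\mapsto\tilde\alpha$, such that $\tilde\alpha=\tilde\beta$ iff $T_\alpha\sim T_\beta$. Every definable $X\subseteq K^n$ has an essentially disjoint pc-presentation, with a primary index quotient (and $\widetilde D$ is definable in the field $F$), and the following are independent of choices: $\mathrm{gr}_K(X)=\max_{\alpha\in D}\mathrm{r}_K(T_\alpha)$, $\mathrm{gr}_F(X)=\mathrm{r}_F(\widetilde D)$. The geometric rank is $\mathrm{gr}(X)=\omega\cdot\mathrm{gr}_K(X)+\mathrm{gr}_F(X)$ (with $\mathrm{gr}(\emptyset)=-\infty$). *)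

(* Defs.v *)
From HB Require Import structures.
From mathcomp Require Import all_boot all_order all_algebra.
From mathcomp Require Import boolp classical_sets.
From mathcomp Require Import mpoly.

Set Implicit Arguments.
Unset Strict Implicit.
Unset Printing Implicit Defensive.

Import GRing.Theory.
Local Open Scope ring_scope.
Local Open Scope classical_set_scope.

(** * Generic characters and models of ACFC_p *)

Definition is_character (F K : idomainType) (chi : F -> K) : Prop :=
  [/\ forall a b, chi (a * b) = chi a * chi b, chi 0 = 0 & chi 1 = 1].

Definition mult_dependent (F : idomainType) n (a : n.-tuple F) : Prop :=
  exists k l : n.-tuple nat, k <> l /\
    \prod_(i < n) tnth a i ^+ tnth k i = \prod_(i < n) tnth a i ^+ tnth l i.

(* [divringClosed L] is the type of (boolean) subfields of the field [L]. *)
Definition prime_field (L : fieldType) : set L :=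
  [set x | forall S : divringClosed L, x \in S].

Definition alg_independent (L : fieldType) (k : set L) n (x : n.-tuple L) :
    Prop :=
  forall P : {mpoly L[n]},
    (forall m, k P@_m) -> P.@[tnth x] = 0 -> P = 0.

Definition is_generic (F K : idomainType) (chi : F -> K) : Prop :=
  injective chi /\
  forall n (a : n.-tuple F), (0 < n)%N -> ~ mult_dependent a ->
    alg_independent (@prime_field {fraction K})
      [tuple of map (fun c => FracField.tofrac (chi c)) a].

Definition has_char (p : nat) (R : nzRingType) : Prop :=
  if p == 0%N then [pchar R] =i pred0 else p \in [pchar R].

Definition ACFC_model (p : nat) (F K : closedFieldType) (chi : F -> K) :
    Prop :=
  [/\ has_char p F, has_char 0 K, is_character chi & is_generic chi].

(** * Definability in the two-sorted structure (F, K; chi) *)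

(* The constants [FCst] and [KCst] play the role of the parameters; they
   include 0 and 1.  As in [GRing.holds], a valuation is a sequence, one for
   each sort, extended by 0. *)
Section TwoSorted.
Variables (F K : closedFieldType) (chi : F -> K).

Inductive fterm : Type :=
| FVar of nat
| FCst of F
| FAdd of fterm & fterm
| FOpp of fterm
| FMul of fterm & fterm.

Inductive kterm : Type :=
| KVar of nat
| KCst of K
| KAdd of kterm & kterm
| KOpp of kterm
| KMul of kterm & kterm
| KChi of fterm.

Inductive lformula : Type :=
| LEqF of fterm & fterm
| LEqK of kterm & kterm
| LNot of lformula
| LAnd of lformula & lformula
| LExF of nat & lformula
| LExK of nat & lformula.

Fixpoint feval (e : seq F) (t : fterm) : F :=
  match t with
  | FVar i => e`_i
  | FCst c => c
  | FAdd t1 t2 => feval e t1 + feval e t2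
  | FOpp t1 => - feval e t1
  | FMul t1 t2 => feval e t1 * feval e t2
  end.

Fixpoint keval (eF : seq F) (eK : seq K) (t : kterm) : K :=
  match t with
  | KVar i => eK`_i
  | KCst c => c
  | KAdd t1 t2 => keval eF eK t1 + keval eF eK t2
  | KOpp t1 => - keval eF eK t1
  | KMul t1 t2 => keval eF eK t1 * keval eF eK t2
  | KChi s => chi (feval eF s)
  end.

Fixpoint lholds (eF : seq F) (eK : seq K) (f : lformula) : Prop :=
  match f with
  | LEqF s t => feval eF s = feval eF t
  | LEqK s t => keval eF eK s = keval eF eK t
  | LNot g => ~ lholds eF eK g
  | LAnd g h => lholds eF eK g /\ lholds eF eK h
  | LExF i g => exists a : F, lholds (set_nth 0 eF i a) eK g
  | LExK i g => exists x : K, lholds eF (set_nth 0 eK i x) g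
  end.

(* Definable subsets of F^k x K^n, of F^k and of K^n. *)
Definition definable k n (A : k.-tuple F -> set (n.-tuple K)) : Prop :=
  exists f : lformula,
    forall (a : k.-tuple F) (x : n.-tuple K), A a x <-> lholds a x f.

Definition definableF k (D : set (k.-tuple F)) : Prop :=
  exists f : lformula, forall a : k.-tuple F, D a <-> lholds a [::] f.

Definition definableK n (X : set (n.-tuple K)) : Prop :=
  exists f : lformula, forall x : n.-tuple K, X x <-> lholds [::] x f.

(* The family (T a)_(a in D); values of [T] outside [D] are irrelevant. *)
Definition definable_family k n (D : set (k.-tuple F))
    (T : k.-tuple F -> set (n.-tuple K)) : Prop :=
  definableF D /\ definable (fun a => [set x | D a /\ T a x]).

End TwoSorted.

Arguments definableF {F K} chi {k} D.

(** * Morley rank and degree in a pure algebraically closed field *)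

Fixpoint map_term (R S : Type) (f : R -> S) (t : GRing.term R) :
    GRing.term S :=
  match t with
  | GRing.Var i => GRing.Var S i
  | GRing.Const c => GRing.Const (f c)
  | GRing.NatConst m => GRing.NatConst S m
  | GRing.Add t1 t2 => GRing.Add (map_term f t1) (map_term f t2)
  | GRing.Opp t1 => GRing.Opp (map_term f t1)
  | GRing.NatMul t1 m => GRing.NatMul (map_term f t1) m
  | GRing.Mul t1 t2 => GRing.Mul (map_term f t1) (map_term f t2)
  | GRing.Inv t1 => GRing.Inv (map_term f t1)
  | GRing.Exp t1 m => GRing.Exp (map_term f t1) m
  end.

Fixpoint map_formula (R S : Type) (f : R -> S) (g : GRing.formula R) :
    GRing.formula S :=
  match g with
  | GRing.Bool b => GRing.Bool b
  | GRing.Equal t1 t2 => GRing.Equal (map_term f t1) (map_term f t2)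
  | GRing.Unit t => GRing.Unit (map_term f t)
  | GRing.And g1 g2 => GRing.And (map_formula f g1) (map_formula f g2)
  | GRing.Or g1 g2 => GRing.Or (map_formula f g1) (map_formula f g2)
  | GRing.Implies g1 g2 => GRing.Implies (map_formula f g1) (map_formula f g2)
  | GRing.Not g1 => GRing.Not (map_formula f g1)
  | GRing.Exists i g1 => GRing.Exists i (map_formula f g1)
  | GRing.Forall i g1 => GRing.Forall i (map_formula f g1)
  end.

(* Formulas are those of [ssralg], with constants for parameters; inverses and
   [Unit] are definable from the ring operations. *)
Definition elementary (M N : closedFieldType) (f : M -> N) : Prop :=
  forall (g : GRing.formula M) (e : seq M),
    GRing.holds e g <-> GRing.holds (map f e) (map_formula f g).

Definition fsubset n (M : closedFieldType) (g h : GRing.formula M) : Prop :=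
  forall x : n.-tuple M, GRing.holds x g -> GRing.holds x h.

Definition fdisjoint n (M : closedFieldType) (g h : GRing.formula M) : Prop :=
  forall x : n.-tuple M, ~ (GRing.holds x g /\ GRing.holds x h).

(* [morley_ge n k g]: the Morley rank of the formula [g] in the variables
   0, ..., n-1 is at least [k].  As usual, the infinite families of disjoint
   subsets live in elementary extensions of [M] and not only in [M]. *)
Fixpoint morley_ge (n k : nat) (M : closedFieldType) (g : GRing.formula M) :
    Prop :=
  match k with
  | 0 => exists x : n.-tuple M, GRing.holds x g
  | k'.+1 =>
    exists (N : closedFieldType) (f : {rmorphism M -> N})
           (h : nat -> GRing.formula N),
      [/\ elementary f,
          forall i, fsubset n (h i) (map_formula f g),
          forall i j, i <> j -> fdisjoint n (h i) (h j)
        & forall i, morley_ge n k' (h i)]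
  end.

(* [g] contains at least [d] disjoint sets of Morley rank at least [r]. *)
Definition morley_split (n r d : nat) (M : closedFieldType)
    (g : GRing.formula M) : Prop :=
  exists (N : closedFieldType) (f : {rmorphism M -> N})
         (h : 'I_d -> GRing.formula N),
    [/\ elementary f,
        forall i, fsubset n (h i) (map_formula f g),
        forall i j, i <> j -> fdisjoint n (h i) (h j)
      & forall i, morley_ge n r (h i)].

Section MorleyRank.
Variables (M : closedFieldType) (n : nat).
Implicit Types X : set (n.-tuple M).

Definition defines (g : GRing.formula M) X : Prop :=
  forall x : n.-tuple M, X x <-> GRing.holds x g.

Definition rank_ge X (k : nat) : Prop :=
  exists g, defines g X /\ morley_ge n k g.

(* [None] stands for -oo, the rank of the empty set.  The rank of a definable
   subset of M^n is at most n, so the default value 0 of [xget] is not used. *)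
Definition mrank X : option nat :=
  if `[< rank_ge X 0 >] then
    Some (xget 0%N [set k | rank_ge X k /\ ~ rank_ge X k.+1])
  else None.

Definition degree_ge X (d : nat) : Prop :=
  exists g r, [/\ defines g X, mrank X = Some r & morley_split n r d g].

(* The degree of the empty set is 0 by convention. *)
Definition mdegree X : nat :=
  xget 0%N [set d | degree_ge X d /\ ~ degree_ge X d.+1].

End MorleyRank.

Definition rle (r s : option nat) : bool :=
  match r, s with
  | None, _ => true
  | Some _, None => false
  | Some a, Some b => (a <= b)%N
  end.

Definition rlt (r s : option nat) : bool := ~~ rle s r.

(** * Geometric rank *)

Definition zariski_closed (K : closedFieldType) n (V : set (n.-tuple K)) :
    Prop :=
  exists I : set {mpoly K[n]},
    V = [set x | forall P, I P -> P.@[tnth x] = 0].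

Section GeometricRank.
Variables (F K : closedFieldType) (chi : F -> K) (n : nat).
Implicit Types T X : set (n.-tuple K).

Definition alg_presentable (S : set (n.-tuple K)) : Prop :=
  exists k (D : set (k.-tuple F)) (V : k.-tuple F -> set (n.-tuple K)),
    [/\ definable_family chi D V,
        forall a, D a -> zariski_closed (V a)
      & S = \bigcup_(a in D) V a].

Definition pc_set T : Prop :=
  exists V S, [/\ zariski_closed V, alg_presentable S & T = V `\` S].

Definition zariski_closure T : set (n.-tuple K) :=
  smallest (@zariski_closed K n) T.

Definition rK T : option nat := mrank (zariski_closure T).
Definition dK T : nat := mdegree (zariski_closure T).

Definition almost_equal T T' : Prop :=
  [/\ rK T = rK T', rK T' = rK (T `&` T'), dK T = dK T'
    & dK T' = dK (T `&` T')].

Definition almost_disjoint T T' : Prop :=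
  rK T = rK T' /\ rlt (rK (T `&` T')) (rK T).

Definition pc_presentation k (D : set (k.-tuple F))
    (T : k.-tuple F -> set (n.-tuple K)) X : Prop :=
  [/\ definable_family chi D T,
      forall a, D a -> pc_set (T a)
    & X = \bigcup_(a in D) T a].

Definition max_rank k (D : set (k.-tuple F))
    (T : k.-tuple F -> set (n.-tuple K)) (r : option nat) : Prop :=
  (exists2 a, D a & rK (T a) = r) /\ forall b, D b -> rle (rK (T b)) r.

Definition primary_index_set k (D : set (k.-tuple F))
    (T : k.-tuple F -> set (n.-tuple K)) : set (k.-tuple F) :=
  [set a | D a /\ max_rank D T (rK (T a))].

Definition essentially_disjoint k (D : set (k.-tuple F))
    (T : k.-tuple F -> set (n.-tuple K)) : Prop :=
  forall a b, primary_index_set D T a -> primary_index_set D T b ->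
    almost_equal (T a) (T b) \/ almost_disjoint (T a) (T b).

(* The surjection from the primary index set to [E] is the restriction of
   [q]; its values elsewhere are irrelevant. *)
Definition primary_index_quotient k (D : set (k.-tuple F))
    (T : k.-tuple F -> set (n.-tuple K)) l (E : set (l.-tuple F))
    (q : k.-tuple F -> l.-tuple F) : Prop :=
  let D' := primary_index_set D T in
  [/\ definableF chi E,
      definableF chi [set [tuple of a ++ q a] | a in D'],
      [set q a | a in D'] = E
    & forall a b, D' a -> D' b -> (q a = q b <-> almost_equal (T a) (T b))].

(* [has_gr X (Some (rhoK, rhoF))]: gr(X) = omega * rhoK + rhoF, and
   [has_gr X None]: gr(X) = -oo.  The value does not depend on the choice of
   the presentation and of its primary index quotient. *)
Definition has_gr X (r : option (nat * nat)) : Prop :=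
  match r with
  | None => X = set0
  | Some (rhoK, rhoF) =>
    exists k (D : set (k.-tuple F)) (T : k.-tuple F -> set (n.-tuple K))
           l (E : set (l.-tuple F)) (q : k.-tuple F -> l.-tuple F),
      [/\ pc_presentation D T X, essentially_disjoint D T,
          primary_index_quotient D T E q, max_rank D T (Some rhoK)
        & mrank E = Some rhoF]
  end.

End GeometricRank.

(* X x X' as a subset of K^(n + n'). *)
Definition set_prod (K : Type) n n' (X : set (n.-tuple K))
    (X' : set (n'.-tuple K)) : set ((n + n').-tuple K) :=
  [set [tuple of x ++ x'] | x in X & x' in X'].

(* Main.v *)
Require Import Defs.
From mathcomp Require Import all_boot all_order all_algebra.
From mathcomp Require Import boolp classical_sets.
From mathcomp Require Import mpoly closed_field zify.

Set Implicit Arguments.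
Unset Strict Implicit.
Unset Printing Implicit Defensive.

Import GRing.Theory Order.TTheory.
Local Open Scope ring_scope.

(** The product of two pc-presentations, with index set [D * D'], family
    [T_a * T'_b] and quotient [q * q'], computes the geometric rank of the
    product. For this one needs the following facts about a pure algebraically
    closed field: Morley rank is additive on products, and, for members of
    maximal rank of two essentially disjoint families, products are almost
    equal exactly when their factors are.

    Morley rank is compared with a dimension [dim_ge] which makes sense for an
    arbitrary set of [n]-tuples: the dimension is at least [k] when some fibre
    over the first coordinate has dimension at least [k], or infinitely many
    fibres have dimension at least [k - 1]. Additivity on products
    ([dim_ge_prod]) is then a formal induction, with no definability involved.
    That Morley rank is this dimension ([morley_geP]) has two halves. A set of
    dimension [k + 1] contains infinitely many disjoint definable sets of
    dimension [k], namely fibres ([dim_ge_disjoint]). Conversely a definable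
    set of dimension [k] contains only a bounded number of disjoint definable
    sets of dimension [k], even in elementary extensions ([degree_bound]). The
    second half rests on quantifier elimination, through a uniform form of
    strong minimality ([uniform_minimality]), and on the definability of the
    dimension ([holds_dim_formula]), which lets it pass to extensions.

    As to degrees: for definable sets [A] inside [B] of the same rank [r], the
    degrees agree iff [B] minus [A] has rank less than [r] ([mdegree_eqP]). So
    almost equality is a statement about ranks, and follows for products from
    additivity ([almost_equal_prod]); and if one pair of factors is almost
    disjoint, so is the pair of products ([almost_disjoint_prod]). Since the
    ranks and degrees of a pc-set are those of its Zariski closure, one also
    needs that closed sets are definable, by Hilbert's basis theorem
    ([closed_finite]), and that the closure of a product is the product of the
    closures ([zariski_closure_prod]).

    What remains is that products of definable sets, of definable families and
    of pc-sets are again such, which is a matter of renaming variables. *)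

(** * Formulas in elementary extensions *)

Lemma map_term_id (R : Type) (t : GRing.term R) : map_term id t = t.
Proof. by elim: t => //= [t -> u ->|t ->|t -> n|t -> u ->|t ->|t -> n]. Qed.

Lemma map_formula_id (R : Type) (g : GRing.formula R) : map_formula id g = g.
Proof.
by elim: g => //= [t u|t|g -> h ->|g -> h ->|g -> h ->|g ->|i g ->|i g ->];
  rewrite ?map_term_id.
Qed.

Lemma elementary_id (M : closedFieldType) :
  elementary (idfun : {rmorphism M -> M}).
Proof. by move=> g e; rewrite /= map_formula_id map_id. Qed.

(** Validity on all [n]-tuples is expressed by one sentence, the universal
    closure over the variables below [n]; the other variables are read as 0. *)
Lemma elementary_forall (M N : closedFieldType) (f : M -> N)
    (g : GRing.formula M) n :
    elementary f -> (forall s, size s = n -> GRing.holds s g) ->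
  forall s, size s = n -> GRing.holds s (map_formula f g).
Proof.
move=> f_el g_n s s_n.
have map_foldr I : map_formula f (foldr GRing.Forall g I) =
    foldr GRing.Forall (map_formula f g) I by elim: I => //= i I ->.
have outside (K : closedFieldType) (e : seq K) : size e = n ->
    {in [predC iota 0 n], GRing.same_env [::] e}.
  move=> e_n i; rewrite inE mem_iota add0n /= -leqNgt => le_ni.
  by rewrite nth_nil nth_default ?e_n.
have /(f_el _ [::]) : GRing.holds [::] (foldr GRing.Forall g (iota 0 n)).
  apply/GRing.foldForallP => e e_out; apply: (@GRing.eq_holds _ (take n (e ++ nseq n 0))).
    move=> i; have [lt_in|le_ni] := ltnP i n.
      rewrite nth_take // nth_cat; case: ltnP => // le_ei.
      by rewrite nth_nseq if_same nth_default.
    rewrite -(e_out i) ?nth_nil ?nth_default ?size_take_min ?geq_minl //.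
      exact: leq_trans (geq_minl _ _) le_ni.
    by rewrite inE mem_iota add0n /= -leqNgt.
  apply: g_n; rewrite size_take size_cat size_nseq.
  by case: ltngtP (leq_addl (size e) n).
rewrite map_foldr /= => /GRing.foldForallP; apply; exact: outside.
Qed.

Lemma quantifier_elimination (M : closedFieldType) (g : GRing.formula M) :
  exists h, [/\ GRing.qf_form h, GRing.rformula h
              & forall e, GRing.holds e g <-> GRing.holds e h].
Proof.
have M_closed : GRing.closed_field_axiom M by exact: solve_monicpoly.
have wf := @ClosedFieldQE.wf_ex_elim M.
have ok := ClosedFieldQE.holds_ex_elim M_closed.
pose h := GRing.quantifier_elim (@ClosedFieldQE.ex_elim M) (GRing.to_rform g).
have rg := GRing.to_rform_rformula g.
have /andP[qh rh] : GRing.qf_form h && GRing.rformula h.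
  exact: GRing.quantifier_elim_wf.
exists h; split=> // e; rewrite -GRing.to_rformP.
apply: (iff_trans (rwP (GRing.quantifier_elim_rformP wf ok e rg))).
apply: iff_sym; exact: (rwP (GRing.qf_evalP _ qh)).
Qed.

(** * Definable subsets of the line *)

(** A root of [prod_(b in s) (X - b) + 1] is not in [s]. *)
Lemma closed_field_infinite (M : closedFieldType) (s : seq M) :
  exists x, x \notin s.
Proof.
case: s => [|a s]; first by exists 0.
pose p : {poly M} := \prod_(b <- a :: s) ('X - b%:P) + 1.
have p_size : size p != 1%N.
  by rewrite size_polyDl size_prod_XsubC ?size_poly1.
have /closed_rootP[x] := p_size; rewrite /root hornerD hornerC => px.
exists x; apply/negP; rewrite -root_prod_XsubC => /rootP x0.
by move: px; rewrite x0 add0r oner_eq0.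
Qed.

Section Minimality.
Variable M : closedFieldType.
Implicit Types (e : seq M) (t : GRing.term M) (g : GRing.formula M).

(** The term [t] as a polynomial in its variable [i], the others being given
    by [e]. Inverses get the value 0: only terms without them are used. *)
Fixpoint term_poly e i t : {poly M} :=
  match t with
  | GRing.Var j => if j == i then 'X else (e`_j)%:P
  | GRing.Const c => c%:P
  | GRing.NatConst n => n%:R
  | GRing.Add u v => term_poly e i u + term_poly e i v
  | GRing.Opp u => - term_poly e i u
  | GRing.NatMul u n => term_poly e i u *+ n
  | GRing.Mul u v => term_poly e i u * term_poly e i v
  | GRing.Inv u => 0
  | GRing.Exp u n => term_poly e i u ^+ n
  end.

Lemma horner_term_poly e i t x : GRing.rterm t ->
  (term_poly e i t).[x] = GRing.eval (set_nth 0 e i x) t.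
Proof.
elim: t => //= [j|c|n|u IHu v IHv|u IHu|u IHu n|u IHu v IHv|u IHu n].
- by rewrite nth_set_nth /=; case: eqP; rewrite ?hornerX ?hornerC.
- by rewrite hornerC.
- by rewrite -polyC_natr hornerC.
- by case/andP=> ru rv; rewrite hornerD IHu ?IHv.
- by move=> ru; rewrite hornerN IHu.
- by move=> ru; rewrite hornerMn IHu.
- by case/andP=> ru rv; rewrite hornerM IHu ?IHv.
- by move=> ru; rewrite horner_exp IHu.
Qed.

End Minimality.

Fixpoint term_degree (R : Type) (t : GRing.term R) : nat :=
  match t with
  | GRing.Var _ => 1
  | GRing.Add u v => maxn (term_degree u) (term_degree v)
  | GRing.Mul u v => term_degree u + term_degree v
  | GRing.Opp u | GRing.NatMul u _ => term_degree u
  | GRing.Exp u n => term_degree u * n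
  | _ => 0
  end.

Lemma size_term_poly (M : closedFieldType) (e : seq M) i t :
  (size (term_poly e i t) <= (term_degree t).+1)%N.
Proof.
elim: t => //= [j|c|n|u IHu v IHv|u IHu|u IHu n|u IHu v IHv|u _|u IHu n].
- by case: eqP; rewrite ?size_polyX // (leq_trans (size_polyC_leq1 _)).
- exact: size_polyC_leq1.
- by rewrite -polyC_natr size_polyC_leq1.
- by rewrite (leq_trans (size_polyD _ _)) // -maxnSS geq_max !leq_max IHu IHv orbT.
- by rewrite size_polyN.
- by rewrite -scaler_nat (leq_trans (size_scale_leq _ _)).
- rewrite (leq_trans (size_polyMleq _ _)) //.
  by move: IHu IHv; do 2!move: (size _) => ?; lia.
- by rewrite size_poly0.
- rewrite (leq_trans (size_poly_exp_leq _ _)) // ltnS leq_mul2r orbC.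
  by move: IHu; case: (size _) => [|a] //=; rewrite ltnS => ->.
Qed.

Definition finite (M : eqType) (P : M -> Prop) :=
  exists s : seq M, forall x, P x -> x \in s.

Definition atmost (M : eqType) N (P : M -> Prop) :=
  exists2 s : seq M, (size s <= N)%N & forall x, P x -> x \in s.

(** A bound, invariant under change of the parameters, on the number of
    values of one variable at which a quantifier-free formula can deviate from
    its generic truth value. *)
Fixpoint formula_degree (R : Type) (g : GRing.formula R) : nat :=
  match g with
  | GRing.Equal t u => maxn (term_degree t) (term_degree u)
  | GRing.And g h | GRing.Or g h | GRing.Implies g h =>
      formula_degree g + formula_degree h
  | GRing.Not g => formula_degree g
  | _ => 0
  end.

(** An equation between terms is a polynomial equation in the variable [i]: it
    holds everywhere, or at finitely many points. *)
Lemma qf_eventually_constant (M : closedFieldType) (g : GRing.formula M) e i :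
    GRing.qf_form g -> GRing.rformula g ->
  exists2 s : seq M, (size s <= formula_degree g)%N
    & exists b : bool, forall x, x \notin s ->
        (GRing.holds (set_nth 0 e i x) g <-> b).
Proof.
elim: g => //= [b _ _|t u _ /andP[rt ru]|g IHg h IHh|g IHg h IHh|g IHg h IHh|g IHg].
- by exists [::] => //; exists b.
- pose p := term_poly e i t - term_poly e i u.
  have p_size : (size p <= (maxn (term_degree t) (term_degree u)).+1)%N.
    rewrite (leq_trans (size_polyD _ _)) // size_polyN -maxnSS.
    by rewrite geq_max !leq_max !size_term_poly orbT.
  have eval_eq x : GRing.eval (set_nth 0 e i x) t =
      GRing.eval (set_nth 0 e i x) u <-> root p x.
    rewrite -!horner_term_poly // /root hornerD hornerN subr_eq0.
    exact: (rwP eqP).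
  have [p0|p_neq0] := eqVneq p 0.
    by exists [::] => //; exists true => x _; rewrite eval_eq p0 root0.
  have [s ps] := closed_field_poly_normal p.
  have root_s x : root p x = (x \in s).
    by rewrite ps rootZ ?lead_coef_eq0 // root_prod_XsubC.
  exists s; last first.
    by exists false => x; rewrite eval_eq root_s => /negPf->.
  rewrite -ltnS (leq_trans _ p_size) // ps size_scale ?lead_coef_eq0 //.
  by rewrite size_prod_XsubC.
- move=> /andP[qg qh] /andP[rg rh]; have [s s_g [b gb]] := IHg qg rg.
  have [s' s_h [b' hb]] := IHh qh rh; exists (s ++ s').
    by rewrite size_cat leq_add.
  exists (b && b') => x; rewrite mem_cat negb_or => /andP[xs xs'].
  by rewrite gb // hb //; split=> /andP.
- move=> /andP[qg qh] /andP[rg rh]; have [s s_g [b gb]] := IHg qg rg.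
  have [s' s_h [b' hb]] := IHh qh rh; exists (s ++ s').
    by rewrite size_cat leq_add.
  exists (b || b') => x; rewrite mem_cat negb_or => /andP[xs xs'].
  by rewrite gb // hb //; split=> /orP.
- move=> /andP[qg qh] /andP[rg rh]; have [s s_g [b gb]] := IHg qg rg.
  have [s' s_h [b' hb]] := IHh qh rh; exists (s ++ s').
    by rewrite size_cat leq_add.
  exists (b ==> b') => x; rewrite mem_cat negb_or => /andP[xs xs'].
  by rewrite gb // hb //; split=> /implyP.
- move=> qg rg; have [s s_g [b gb]] := IHg qg rg; exists s => //.
  by exists (~~ b) => x xs; rewrite gb //; split=> /negP.
Qed.

Lemma formula_degree_map (R S : Type) (f : R -> S) g :
  formula_degree (map_formula f g) = formula_degree g.
Proof.
have term_degree_map t : term_degree (map_term f t) = term_degree t.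
  by elim: t => //= [t -> u ->|t -> u ->|t ->].
by elim: g => //= [t u|g -> h ->|g -> h ->|g -> h ->]; rewrite ?term_degree_map.
Qed.

Lemma qf_form_map (R S : unitRingType) (f : R -> S) g :
  GRing.qf_form (map_formula f g) = GRing.qf_form g.
Proof. by elim: g => //= [g -> h ->|g -> h ->|g -> h ->]. Qed.

Lemma rformula_map (R S : unitRingType) (f : R -> S) g :
  GRing.rformula (map_formula f g) = GRing.rformula g.
Proof.
have rterm_map t : GRing.rterm (map_term f t) = GRing.rterm t.
  by elim: t => //= [t -> u ->|t -> u ->].
by elim: g => //= [t u|g -> h ->|g -> h ->|g -> h ->]; rewrite ?rterm_map.
Qed.

(** Quantifier elimination over [M] stays valid in every elementary extension
    [L], with the image formula, and the number of exceptions is bounded by the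
    syntactic degree, which the extension does not change. *)
Lemma uniform_minimality (M : closedFieldType) (g : GRing.formula M) :
  exists N, forall (L : closedFieldType) (f : M -> L) (e : seq L) i,
    elementary f ->
    atmost N (fun x => GRing.holds (set_nth 0 e i x) (map_formula f g)) \/
    atmost N (fun x => ~ GRing.holds (set_nth 0 e i x) (map_formula f g)).
Proof.
have [h [qh rh gh]] := quantifier_elimination g.
exists (formula_degree h) => L f e i f_el.
have gh_L e' : GRing.holds e' (map_formula f g) <-> GRing.holds e' (map_formula f h).
  pose gh_form := GRing.And (GRing.Implies g h) (GRing.Implies h g).
  have gh_M s : size s = size e' -> GRing.holds s gh_form by split=> /gh.
  by have [] := elementary_forall f_el gh_M (erefl (size e')).
have [] := @qf_eventually_constant L (map_formula f h) e i.
- by rewrite qf_form_map.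
- by rewrite rformula_map.
move=> s; rewrite formula_degree_map => s_h [b hb].
case: b hb => hb; [right|left]; exists s => // x; rewrite gh_L => hx.
  by apply/negPn/negP => xs; apply: hx; apply/hb.
by apply/negPn/negP => xs; have /hb := xs; case=> /(_ hx).
Qed.

Section Finite.
Variable M : eqType.
Implicit Types P Q : M -> Prop.

Lemma finite_sub P Q : (forall x, P x -> Q x) -> finite Q -> finite P.
Proof. by move=> PQ [s sQ]; exists s => x /PQ/sQ. Qed.

Lemma finite_or P Q : finite P -> finite Q -> finite (fun x => P x \/ Q x).
Proof.
move=> [s Ps] [s' Qs']; exists (s ++ s') => x.
by rewrite mem_cat => -[/Ps->|/Qs'->]; rewrite ?orbT.
Qed.

Lemma finite_bigor (P : nat -> M -> Prop) n :
    (forall i, (i < n)%N -> finite (P i)) ->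
  finite (fun x => exists2 i, (i < n)%N & P i x).
Proof.
elim: n => [|n IHn] finP; first by exists [::] => x [].
have finPn := IHn (fun i lt_in => finP i (ltnW lt_in)).
apply: finite_sub (finite_or finPn (finP n (ltnSn n))) => x [i].
by rewrite ltnS leq_eqVlt => /orP[/eqP->|lt_in] Pix; [right|left; exists i].
Qed.

Lemma infinite_ex P : ~ finite P -> exists x, P x.
Proof.
move=> infP; apply: contrapT => nP; apply: infP.
by exists [::] => x Px; case: nP; exists x.
Qed.

Lemma atmost_finite N P : atmost N P -> finite P.
Proof. by case=> s _ sP; exists s. Qed.

End Finite.

(** * A dimension for arbitrary sets of tuples *)

Fixpoint dim_ge (M : eqType) n k (A : seq M -> Prop) : Prop :=
  match n with
  | 0 => k = 0%N /\ A [::]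
  | n'.+1 =>
    (exists x, dim_ge n' k (fun s => A (x :: s))) \/
    exists2 k', k = k'.+1 & ~ finite (fun x => dim_ge n' k' (fun s => A (x :: s)))
  end.

Section Dimension.
Variable M : eqType.
Implicit Types (A B : seq M -> Prop) (n k : nat).

Lemma dim_ge_sub n k A B : (forall s, size s = n -> A s -> B s) ->
  dim_ge n k A -> dim_ge n k B.
Proof.
elim: n k A B => [|n IHn] k A B AB /=; first by case=> -> /AB A0; split; auto.
have fib x j : dim_ge n j (fun s => A (x :: s)) -> dim_ge n j (fun s => B (x :: s)).
  by apply: IHn => s s_n; apply: AB; rewrite /= s_n.
case=> [[x Ax]|[k' -> infA]]; [left; exists x; exact: fib|right].
by exists k' => //; apply: contra_not infA; apply: finite_sub => x; apply: fib.
Qed.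

Lemma dim_ge_eq n k A B : (forall s, size s = n -> A s <-> B s) ->
  dim_ge n k A <-> dim_ge n k B.
Proof. by move=> AB; split; apply: dim_ge_sub => s /AB []. Qed.

Lemma dim_geS n k A : dim_ge n k.+1 A -> dim_ge n k A.
Proof.
elim: n k A => [|n IHn] k A /=; first by case.
case=> [[x /IHn Ax]|[k' [<-] /infinite_ex[x Ax]]]; left; by exists x.
Qed.

Lemma dim_ge_le n k k' A : (k' <= k)%N -> dim_ge n k A -> dim_ge n k' A.
Proof.
move/subnK<-; elim: (k - k')%N => // j IHj; rewrite addSn => /dim_geS; exact: IHj.
Qed.

Lemma dim_ge_leq n k A : dim_ge n k A -> (k <= n)%N.
Proof.
elim: n k A => [|n IHn] k A /=; first by case=> ->.
by case=> [[x /IHn/leqW]|[k' -> /infinite_ex[x /IHn]]].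
Qed.

(** A union of two sets is infinite only if one of them is. *)
Lemma dim_ge_or n k A B :
  dim_ge n k (fun s => A s \/ B s) <-> dim_ge n k A \/ dim_ge n k B.
Proof.
split; last by case; apply: dim_ge_sub; auto.
elim: n k A B => [|n IHn] k A B /=; first by case=> -> [] ?; auto.
case=> [[x /IHn[]]|[k' -> inf]]; [by left; left; exists x|by right; left; exists x|].
have [finA|infA] := pselect (finite (fun x => dim_ge n k' (fun s => A (x :: s)))).
  right; right; exists k' => // finB; apply: inf.
  by apply: finite_sub (finite_or finA finB) => x; apply: IHn.
by left; right; exists k'.
Qed.

Lemma dim_ge0 n A : dim_ge n 0 A <-> exists2 s, size s = n & A s.
Proof.
elim: n A => [|n IHn] A /=.
  by split=> [[_ A0]|[s /size0nil-> ?]]; [exists [::]|].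
split=> [[[x /IHn[s s_n Axs]]|[]//]|[[|x s] //= [s_n] Axs]].
  by exists (x :: s); rewrite /= ?s_n.
by left; exists x; apply/IHn; exists s.
Qed.

(** By induction on [n], the fibre of the product being the product of a fibre
    with [B]. If infinitely many fibres of the product have dimension at least
    [k'], then one of the finitely many decompositions [k' = i + j] occurs for
    infinitely many of them. *)
Lemma dim_ge_prod n n' k A B :
  dim_ge (n + n') k (fun s => A (take n s) /\ B (drop n s)) <->
  exists i j, [/\ k = (i + j)%N, dim_ge n i A & dim_ge n' j B].
Proof.
elim: n k A => [|n IHn] k A.
  rewrite add0n; transitivity (A [::] /\ dim_ge n' k B).
    have [A0|nA0] := pselect (A [::]).
      by split=> [d|[_]]; [split=> //; move: d|]; apply: dim_ge_sub => s _;
        rewrite take0 drop0 => // -[].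
    split=> [/(dim_ge_le (leq0n k))/dim_ge0[s _]|[]//].
    by rewrite take0 => -[].
  split=> [[A0 dB]|[i [j [-> [-> A0] dB]]]]; last by split.
  by exists 0%N, k; split.
rewrite addSn /=; split.
  case=> [[x /(IHn k (fun s => A (x :: s)))[i [j [-> dA dB]]]]|[k' -> inf]].
    by exists i, j; split=> //; left; exists x.
  apply: contrapT => nprod; apply: inf.
  pose P i x := dim_ge n i (fun s => A (x :: s)) /\ dim_ge n' (k' - i) B.
  have : finite (fun x => exists2 i, (i < k'.+1)%N & P i x).
    apply: finite_bigor => i lt_ik.
    have [dB|ndB] := pselect (dim_ge n' (k' - i) B); last by exists [::] => x [].
    apply: contrapT => infA; apply: nprod; exists i.+1, (k' - i)%N; split=> //.
      by rewrite addSn subnKC.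
    by right; exists i => //; apply: contra_not infA; apply: finite_sub => x [].
  apply: finite_sub => x /(IHn k' (fun s => A (x :: s)))[i [j [k'E dA dB]]].
  exists i; first by rewrite k'E ltnS leq_addr.
  by split=> //; rewrite k'E addKn.
move=> [i [j [-> [[x dA]|[i' -> inf]] dB]]].
  by left; exists x; apply/(IHn _ (fun s => A (x :: s))); exists i, j.
right; exists (i' + j)%N => //; apply: contra_not inf; apply: finite_sub => x dA.
by apply/(IHn _ (fun s => A (x :: s))); exists i', j.
Qed.

End Dimension.

(** * Definability of dimension *)

(** Strictly above all free and bound variables of the formula. *)
Fixpoint formula_ub (R : unitRingType) (g : GRing.formula R) : nat :=
  match g with
  | GRing.Bool _ => 0
  | GRing.Equal t u => maxn (GRing.ub_var t) (GRing.ub_var u)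
  | GRing.Unit t => GRing.ub_var t
  | GRing.And g h | GRing.Or g h | GRing.Implies g h =>
      maxn (formula_ub g) (formula_ub h)
  | GRing.Not g => formula_ub g
  | GRing.Exists i g | GRing.Forall i g => maxn i.+1 (formula_ub g)
  end.

Lemma formula_ub_map (R S : unitRingType) (f : R -> S) g :
  formula_ub (map_formula f g) = formula_ub g.
Proof.
have ub_var_map t : GRing.ub_var (map_term f t) = GRing.ub_var t.
  by elim: t => //= [t -> u ->|t -> u ->].
by elim: g => //= [t u|g -> h ->|g -> h ->|g -> h ->|i g ->|i g ->];
  rewrite ?ub_var_map.
Qed.

Section Definability.
Variable M : closedFieldType.
Implicit Types (e : seq M) (g h : GRing.formula M).

Definition agree b e e' := forall j, (j < b)%N -> e`_j = e'`_j.

Lemma agree_le b b' e e' : (b <= b')%N -> agree b' e e' -> agree b e e'.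
Proof. by move=> le_bb' ee' j lt_jb; apply: ee'; apply: leq_trans le_bb'. Qed.

Lemma agree_set b e e' i x :
  agree b e e' -> agree b (set_nth 0 e i x) (set_nth 0 e' i x).
Proof. by move=> ee' j lt_jb; rewrite !nth_set_nth /= ee'. Qed.

Lemma eval_agree e e' t : agree (GRing.ub_var t) e e' ->
  GRing.eval e t = GRing.eval e' t.
Proof.
elim: t => //= [j|t IHt u IHu|t IHt|t IHt n|t IHt u IHu|t IHt|t IHt n] ee'.
- exact: ee'.
- by rewrite IHt ?IHu //; apply: agree_le ee'; rewrite (leq_maxl, leq_maxr).
- by rewrite IHt.
- by rewrite IHt.
- by rewrite IHt ?IHu //; apply: agree_le ee'; rewrite (leq_maxl, leq_maxr).
- by rewrite IHt.
- by rewrite IHt.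
Qed.

Lemma holds_agree b e e' g : (formula_ub g <= b)%N -> agree b e e' ->
  GRing.holds e g <-> GRing.holds e' g.
Proof.
elim: g b e e' => //= [t u|t|g IHg h IHh|g IHg h IHh|g IHg h IHh|g IHg|i g IHg|i g IHg] b e e'.
- rewrite geq_max => /andP[tb ub] ee'.
  by rewrite !(@eval_agree e e') //; apply: agree_le ee'.
- by move=> tb ee'; rewrite (@eval_agree e e') //; apply: agree_le ee'.
- by rewrite geq_max => /andP[gb hb] ee'; rewrite (IHg b e e') // (IHh b e e').
- by rewrite geq_max => /andP[gb hb] ee'; rewrite (IHg b e e') // (IHh b e e').
- by rewrite geq_max => /andP[gb hb] ee'; rewrite (IHg b e e') // (IHh b e e').
- by move=> gb ee'; rewrite (IHg b e e').
- rewrite geq_max => /andP[_ gb] ee'.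
  have gE x := IHg b _ _ gb (agree_set i x ee').
  by split=> -[x /gE gx]; exists x.
- rewrite geq_max => /andP[_ gb] ee'.
  have gE x := IHg b _ _ gb (agree_set i x ee').
  by split=> gx x; apply/gE.
Qed.

Lemma minimality e i g :
  finite (fun x => GRing.holds (set_nth 0 e i x) g) \/
  finite (fun x => ~ GRing.holds (set_nth 0 e i x) g).
Proof.
have [N] := uniform_minimality g => /(_ M idfun e i (@elementary_id M)).
by rewrite map_formula_id; case=> /atmost_finite; [left|right].
Qed.

(** Infinity is first-order for finite or cofinite sets, uniformly and without
    counting: a cofinite set meets all its translates, whereas the differences
    of elements of a finite set are finite in number. *)
Lemma infinite_differences (P : M -> Prop) : finite P \/ finite (fun x => ~ P x) ->
  (forall z, exists2 a, P a & exists2 c, P c & a = c + z) <-> ~ finite P.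
Proof.
move=> minP; split=> [Pz [s sP]|infP z].
  have [z] := closed_field_infinite [seq a - c | a <- s, c <- s].
  case: (Pz z) => a /sP a_s [c /sP c_s ac] /negP; apply; apply/allpairsP.
  by exists (a, c); split; rewrite //= ac addrAC subrr add0r.
case: minP => // -[s sP].
have [c] := closed_field_infinite (s ++ [seq a - z | a <- s]).
rewrite mem_cat negb_or => /andP[c_s cz_s]; exists (c + z).
  apply: contrapT => /sP cz; case/negP: cz_s; apply/mapP; exists (c + z) => //.
  by rewrite addrK.
by exists c => //; apply: contrapT => /sP; apply/negP.
Qed.

End Definability.

(** The criterion of [infinite_differences] as a formula: for all [z] there are
    [a] and [c] satisfying [g] with [a = c + z]. The variable [i] of [g] serves
    for [a] and then for [c]; [z] and a copy of [a] are stored in the fresh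
    variables [b] and [b + 1]. *)
Definition ex_inf (R : unitRingType) i (g : GRing.formula R) : GRing.formula R :=
  let b := maxn i.+1 (formula_ub g) in
  GRing.Forall b (GRing.Exists i (GRing.And g
    (GRing.Exists b.+1 (GRing.And (GRing.Equal (GRing.Var R b.+1) (GRing.Var R i))
      (GRing.Exists i (GRing.And g
        (GRing.Equal (GRing.Var R b.+1) (GRing.Add (GRing.Var R i) (GRing.Var R b))))))))).

Lemma holds_ex_inf (M : closedFieldType) (e : seq M) i g :
  GRing.holds e (ex_inf i g) <->
  ~ finite (fun x => GRing.holds (set_nth 0 e i x) g).
Proof.
rewrite -(infinite_differences (minimality e i g)) /ex_inf /=.
set b := maxn _ _; have lt_ib : (i < b)%N by rewrite leq_maxl.
have ub_g : (formula_ub g <= b)%N by rewrite leq_maxr.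
have fresh z x : GRing.holds (set_nth 0 (set_nth 0 e b z) i x) g <->
    GRing.holds (set_nth 0 e i x) g.
  apply: (@holds_agree _ b) => //; apply: agree_set => j lt_jb.
  by rewrite nth_set_nth /= ltn_eqF.
have fresh2 z x c y : GRing.holds
    (set_nth 0 (set_nth 0 (set_nth 0 (set_nth 0 e b z) i x) b.+1 c) i y) g <->
    GRing.holds (set_nth 0 e i y) g.
  apply: (@holds_agree _ b) => // j lt_jb.
  do 4!rewrite nth_set_nth /=; rewrite nth_set_nth /=.
  by case: eqP => // _; rewrite (ltn_eqF lt_jb) (ltn_eqF (leqW lt_jb)).
have values z x c y :
    let e3 := set_nth 0 (set_nth 0 (set_nth 0 e b z) i x) b.+1 c in
    let e4 := set_nth 0 e3 i y in
    [/\ e3`_b.+1 = c, e3`_i = x, e4`_b.+1 = c, e4`_i = y & e4`_b = z].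
  have [ib bi] : (i == b) = false /\ (b == i) = false.
    by rewrite [b == i]eq_sym ltn_eqF.
  have [ib1 bi1] : (i == b.+1) = false /\ (b.+1 == i) = false.
    by rewrite [b.+1 == i]eq_sym ltn_eqF ?leqW.
  have b1b : (b == b.+1) = false by rewrite ltn_eqF.
  by split; do ?[rewrite nth_set_nth /=]; rewrite ?eqxx ?ib1 ?bi1 ?bi ?b1b ?eqxx.
split=> Pz z; have := Pz z.
  case=> x [/fresh gx [c]]; have [-> -> _ _ _] := values z x c 0.
  case=> -> [y [/fresh2 gy]]; have [_ _ -> -> ->] := values z x x y.
  by exists x => //; exists y.
case=> x gx [y gy xyz]; exists x; split; first exact/fresh.
exists x; have [-> -> _ _ _] := values z x x 0; split=> //.
exists y; split; first exact/fresh2.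
by have [_ _ -> -> ->] := values z x x y.
Qed.

Lemma ex_inf_map (R S : unitRingType) (f : R -> S) i g :
  map_formula f (ex_inf i g) = ex_inf i (map_formula f g).
Proof. by rewrite /ex_inf /= formula_ub_map. Qed.

(** Follows the definition of [dim_ge], the coordinates being the variables
    [m, ..., m + n - 1] and the variables below [m] being parameters. *)
Fixpoint dim_formula (R : unitRingType) m n k (g : GRing.formula R) :=
  match n with
  | 0 => if k == 0%N then g else GRing.Bool false
  | n'.+1 => GRing.Or (GRing.Exists m (dim_formula m.+1 n' k g))
      (if k is k'.+1 then ex_inf m (dim_formula m.+1 n' k' g)
       else GRing.Bool false)
  end.

Lemma dim_formula_map (R S : unitRingType) (f : R -> S) m n k g :
  map_formula f (dim_formula m n k g) = dim_formula m n k (map_formula f g).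
Proof.
elim: n m k => [|n IHn] m k /=; first by case: eqP.
by rewrite IHn; case: k => [|k]; rewrite // ex_inf_map IHn.
Qed.

Lemma set_nth_rcons (T : Type) (x0 : T) s x :
  set_nth x0 s (size s) x = rcons s x.
Proof. by elim: s => //= y s ->. Qed.

Lemma holds_dim_formula (M : closedFieldType) (pre : seq M) n k g :
  GRing.holds pre (dim_formula (size pre) n k g) <->
  dim_ge n k (fun s => GRing.holds (pre ++ s) g).
Proof.
elim: n pre k => [|n IHn] pre k /=.
  by rewrite cats0; case: eqP => [->|]; [split=> [|[]] | split=> [|[]]].
have fib x j : GRing.holds (set_nth 0 pre (size pre) x)
    (dim_formula (size pre).+1 n j g) <->
    dim_ge n j (fun s => GRing.holds (pre ++ x :: s) g).
  rewrite set_nth_rcons -(size_rcons pre x) IHn.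
  by apply: dim_ge_eq => s _; rewrite cat_rcons.
split=> [[[x /fib dx]|]|[[x /fib dx]|[k' -> infA]]].
- by left; exists x.
- case: k => // k /holds_ex_inf infA; right; exists k => //.
  by apply: contra_not infA; apply: finite_sub => x /fib.
- by left; exists x.
- right; apply/holds_ex_inf; apply: contra_not infA.
  by apply: finite_sub => x /fib.
Qed.

(** The dimension is given by the sentence [dim_formula 0 n k g]. *)
Lemma dim_ge_elementary (M N : closedFieldType) (f : M -> N) n k g :
    elementary f ->
  dim_ge n k (fun s => GRing.holds s (map_formula f g)) <->
  dim_ge n k (fun s => GRing.holds s g).
Proof.
move=> f_el; rewrite -(holds_dim_formula [::]) -(holds_dim_formula [::]) /=.
by rewrite -dim_formula_map; apply: iff_sym; apply: f_el _ [::].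
Qed.

(** * Finiteness of degree *)

(** The pigeonhole principle for a classification [r] of the entries of [t]
    into the classes [s], a class having at most [e] members. *)
Lemma size_le_cover (I J : eqType) (r : I -> J -> Prop) (s : seq J) (t : seq I) e :
    (forall j, j \in s -> forall u : seq I, subseq u t ->
       (forall i, i \in u -> r i j) -> (size u <= e)%N) ->
    (forall i, i \in t -> exists2 j, j \in s & r i j) ->
  (size t <= size s * e)%N.
Proof.
elim: s t => [|j s IHs] t small cover.
  by case: t cover {small} => // i t /(_ i (mem_head _ _))[j]; rewrite in_nil.
rewrite -(count_predC [pred i | `[< r i j >]]) /= mulSn leq_add //.
  rewrite -size_filter (small j) ?mem_head ?filter_subseq // => i.
  by rewrite mem_filter => /andP[/asboolP].
rewrite -size_filter; apply: IHs => [j' j's u u_t|i].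
  apply: small; first by rewrite in_cons j's orbT.
  exact: subseq_trans u_t (filter_subseq _ _).
rewrite mem_filter /= => /andP[/asboolPn nrij /cover[j']].
by rewrite in_cons => /orP[/eqP->|] // j's; exists j'.
Qed.

(** The first [m] variables of [g] are parameters [pre]; the bound [e] is
    required to be uniform in them and in the elementary extension [L]: the
    uniformity in [pre] is what makes induction on [n] possible, and the one in
    [L] is what makes the Morley degree finite, as its witnesses may live in
    different extensions for different numbers of pieces. *)
Definition degree_le (M : closedFieldType) n m k (g : GRing.formula M) e :=
  forall (L : closedFieldType) (f : M -> L) (pre : seq L),
    elementary f -> size pre = m ->
    ~ dim_ge n k.+1 (fun s => GRing.holds (pre ++ s) (map_formula f g)) ->
  forall (I : eqType) (h : I -> GRing.formula L) (t : seq I), uniq t ->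
    (forall i, i \in t -> forall s, size s = n ->
       GRing.holds (pre ++ s) (h i) -> GRing.holds (pre ++ s) (map_formula f g)) ->
    (forall i j, i \in t -> j \in t -> i <> j -> forall s, size s = n ->
       ~ (GRing.holds (pre ++ s) (h i) /\ GRing.holds (pre ++ s) (h j))) ->
    (forall i, i \in t -> dim_ge n k (fun s => GRing.holds (pre ++ s) (h i))) ->
  (size t <= e)%N.

(** Cut along the first coordinate [x]. Only finitely many fibres of [g], at
    most [N] say, have full dimension [k]. A piece of dimension [k] either has
    dimension [k] over one of these [N] points, or has dimension [k - 1] over
    infinitely many points, hence over all but finitely many of them; pieces of
    the second kind all show up in one and the same fibre of [g], a fibre of
    dimension [k - 1]. By induction there are at most [N * e1 + e2] pieces. *)
Lemma degree_bound (M : closedFieldType) n m k (g : GRing.formula M) :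
  exists e, degree_le n m k g e.
Proof.
elim: n m k => [|n IHn] m k.
  exists 1%N => L f pre _ _ _ I h [|i [|j t]] //= /andP[].
  rewrite in_cons negb_or => /andP[/eqP ne_ij _] _ _ disj dh.
  have [i_t j_t] : i \in [:: i, j & t] /\ j \in [:: i, j & t].
    by rewrite !in_cons !eqxx orbT.
  case: (disj i j i_t j_t ne_ij [::] erefl).
  by have [[_ ?] [_ ?]] := (dh i i_t, dh j j_t).
(* N bounds the number of special fibres, e1 the number of pieces of dimension
   k over each of them, e2 the number of pieces in a general fibre. *)
have [N minN] := uniform_minimality (dim_formula m.+1 n k g).
have [e1 deg1] := IHn m.+1 k.
have [e2 deg2] : exists e2, forall k', k = k'.+1 -> degree_le n m.+1 k' g e2.
  case: k {deg1 N minN} => [|k']; first by exists 0%N.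
  by have [e2 deg2] := IHn m.+1 k'; exists e2 => _ [<-].
exists (N * e1 + e2)%N => L f pre f_el pre_m dimA I h t t_uniq sub disj dh.
set A := fun s => _ in dimA.
have fib x j g' : dim_ge n j (fun s => GRing.holds (pre ++ x :: s) g') <->
    dim_ge n j (fun s => GRing.holds (rcons pre x ++ s) g').
  by apply: dim_ge_eq => s _; rewrite cat_rcons.
have sub_x x i : i \in t -> forall s, size s = n ->
    GRing.holds (rcons pre x ++ s) (h i) ->
    GRing.holds (rcons pre x ++ s) (map_formula f g).
  by move=> i_t s s_n; rewrite cat_rcons; apply: sub; rewrite //= s_n.
have disj_x x i j : i \in t -> j \in t -> i <> j -> forall s, size s = n ->
    ~ (GRing.holds (rcons pre x ++ s) (h i) /\ GRing.holds (rcons pre x ++ s) (h j)).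
  move=> i_t j_t ne_ij s s_n; rewrite cat_rcons.
  by apply: disj; rewrite //= s_n.
have finA : finite (fun x => dim_ge n k (fun s => A (x :: s))).
  by apply: contrapT => infA; apply: dimA; right; exists k.
have [S S_N AS] : atmost N (fun x => dim_ge n k (fun s => A (x :: s))).
  have AE x : GRing.holds (set_nth 0 pre m x) (map_formula f (dim_formula m.+1 n k g))
      <-> dim_ge n k (fun s => A (x :: s)).
    rewrite dim_formula_map -pre_m set_nth_rcons -(size_rcons pre x).
    by rewrite holds_dim_formula -fib.
  have [[S S_N AS]|[S S_N AS]] := minN L f pre m f_el.
    by exists S => // x /AE/AS.
  have [s As] := finA; have [x] := closed_field_infinite (S ++ s).
  rewrite mem_cat negb_or => /andP[/negP xS /negP xs].
  by case: xS; apply: AS => /AE/As.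
(* A piece is special if its dimension k is attained in a single fibre. *)
pose over i x := dim_ge n k (fun s => GRing.holds (pre ++ x :: s) (h i)).
pose special i := `[< exists2 x, x \in S & over i x >].
rewrite -(count_predC special) leq_add //; rewrite -size_filter.
  apply: (@leq_trans (size S * e1)); last by rewrite leq_mul2r S_N orbT.
  apply: (@size_le_cover _ _ over).
    move=> x xS u u_t du.
    have u_sub i : i \in u -> i \in t.
      by move/(mem_subseq u_t); rewrite mem_filter => /andP[].
    apply: (deg1 L f (rcons pre x) f_el _ _ I h).
    - by rewrite size_rcons pre_m.
    - by rewrite -fib; apply: contra_not dimA => dA; left; exists x.
    - by apply: subseq_uniq u_t _; apply: filter_uniq.
    - by move=> i /u_sub; apply: sub_x.
    - by move=> i j /u_sub i_t /u_sub j_t; apply: disj_x.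
    - by move=> i /du/fib.
  by move=> i; rewrite mem_filter => /andP[/asboolP].
set u := filter _ _.
have u_sub i : i \in u -> i \in t by rewrite mem_filter => /andP[].
have infu i : i \in u -> exists2 k', k = k'.+1 &
    ~ finite (fun x => dim_ge n k' (fun s => GRing.holds (pre ++ x :: s) (h i))).
  rewrite mem_filter => /andP[/asboolPn nspec i_t].
  have [[x dx]|//] := dh i i_t; case: nspec; exists x => //; apply: AS.
  apply: dim_ge_sub dx => s s_n; apply: sub; rewrite //= s_n //.
case: (posnP (size u)) => [->//|]; rewrite -has_predT => /hasP[i0 i0u _].
have [k' kE _] := infu i0 i0u.
have cofin i : i \in u ->
    finite (fun x => ~ dim_ge n k' (fun s => GRing.holds (pre ++ x :: s) (h i))).
  move=> iu; have [k'' kE'] := infu i iu.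
  have {kE'}<- : k' = k'' by move: kE'; rewrite kE => -[].
  have AE x : GRing.holds (set_nth 0 pre (size pre) x) (dim_formula (size pre).+1 n k' (h i))
      <-> dim_ge n k' (fun s => GRing.holds (pre ++ x :: s) (h i)).
    by rewrite set_nth_rcons -(size_rcons pre x) holds_dim_formula -fib.
  have [fin|fin _] := minimality pre (size pre) (dim_formula (size pre).+1 n k' (h i)).
    by case; apply: finite_sub fin => x /AE.
  by apply: finite_sub fin => x; apply: contra_not => /AE.
(* A point x outside bad and S gives a fibre of g of dimension k - 1 that
   every remaining piece meets in dimension k - 1. *)
have [bad bad_u] : finite (fun x => exists2 i, i \in u &
    ~ dim_ge n k' (fun s => GRing.holds (pre ++ x :: s) (h i))).
  elim: u cofin {u_sub infu i0u} => [|i u IHu] cofin; first by exists [::] => x [].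
  have finu := IHu (fun j ju => cofin j (@mem_behead _ (i :: u) j ju)).
  apply: finite_sub (finite_or (cofin i (mem_head _ _)) finu) => x [j].
  by rewrite in_cons => /orP[/eqP->|ju] ndx; [left|right; exists j].
have [x] := closed_field_infinite (S ++ bad).
rewrite mem_cat negb_or => /andP[/negP xS /negP xbad].
apply: (deg2 k' kE L f (rcons pre x) f_el _ _ I h).
- by rewrite size_rcons pre_m.
- by rewrite -fib -kE; apply: contra_not xS => /AS.
- exact: filter_uniq.
- by move=> i /u_sub; apply: sub_x.
- by move=> i j /u_sub i_t /u_sub j_t; apply: disj_x.
- move=> i iu; apply/fib; apply: contrapT => ndx; apply: xbad; apply: bad_u.
  by exists i.
Qed.

(** * Morley rank is dimension *)

Lemma infinite_sequence (M : eqType) (P : M -> Prop) : ~ finite P ->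
  exists2 u : nat -> M, injective u & forall i, P (u i).
Proof.
move=> infP.
have fresh (s : seq M) : exists x, P x /\ x \notin s.
  apply: contrapT => nfresh; apply: infP; exists s => x Px.
  by apply: contrapT => /negP xs; apply: nfresh; exists x.
have [F FP] := boolp.choice fresh.
pose prefix_ := fix prefix_ i := if i is j.+1 then F (prefix_ j) :: prefix_ j else [::].
have mem_prefix i j : (i < j)%N -> F (prefix_ i) \in prefix_ j.
  elim: j => // j IHj; rewrite ltnS leq_eqVlt => /orP[/eqP->|/IHj ij].
    exact: mem_head.
  by rewrite in_cons ij orbT.
exists (fun i => F (prefix_ i)) => [i j Fij|i]; last by case: (FP (prefix_ i)).
have [lt_ij|lt_ji|//] := ltngtP i j.
  by have [_] := FP (prefix_ j); rewrite -Fij mem_prefix.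
by have [_] := FP (prefix_ i); rewrite Fij mem_prefix.
Qed.

(** The pieces are the fibres over the infinitely many [x] of the definition
    of [dim_ge], or come by induction from within a single fibre. They are
    definable with parameters in [M] itself. *)
Lemma dim_ge_disjoint (M : closedFieldType) n k (pre : seq M) g :
    dim_ge n k.+1 (fun s => GRing.holds (pre ++ s) g) ->
  exists h : nat -> GRing.formula M,
    [/\ forall i s, size s = n -> GRing.holds (pre ++ s) (h i) ->
          GRing.holds (pre ++ s) g,
        forall i j, i <> j -> forall s, size s = n ->
          ~ (GRing.holds (pre ++ s) (h i) /\ GRing.holds (pre ++ s) (h j))
      & forall i, dim_ge n k (fun s => GRing.holds (pre ++ s) (h i))].
Proof.
pose at_ x h : GRing.formula M :=
  GRing.And h (GRing.Equal (GRing.Var M (size pre)) (GRing.Const x)).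
elim: n pre @at_ => [|n IHn] pre at_ /=; first by case.
have holds_at x h y s : GRing.holds (pre ++ y :: s) (at_ x h) <->
    GRing.holds (pre ++ y :: s) h /\ y = x.
  by rewrite /= nth_cat ltnn subnn.
case=> [[x dx]|[_ [<-] inf]].
  have [|h [sub disj dh]] := IHn (rcons pre x).
    by apply: dim_ge_sub dx => s _; rewrite cat_rcons.
  exists (fun i => at_ x (h i)); split.
  - move=> i [|y s] // [s_n] /holds_at[hs yx]; move: hs; rewrite yx -cat_rcons.
    exact: sub.
  - move=> i j ne_ij [|y s] // [s_n] [/holds_at[his yx] /holds_at[hjs _]].
    by apply: (disj i j ne_ij s s_n); rewrite cat_rcons -yx.
  - move=> i; left; exists x; apply: dim_ge_sub (dh i) => s _.
    by rewrite cat_rcons => hs; apply/holds_at.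
have [u u_inj uP] := infinite_sequence inf.
exists (fun i => at_ (u i) g); split.
- by move=> i [|y s] // [s_n] /holds_at[].
- move=> i j ne_ij [|y s] // [s_n] [/holds_at[_ ->] /holds_at[_ /u_inj]].
  exact: ne_ij.
- move=> i; left; exists (u i); apply: dim_ge_sub (uP i) => s _ gs.
  exact/holds_at.
Qed.

(** The infinitely many disjoint pieces that Morley rank asks for may live in
    an extension [N]; there they violate [degree_bound] unless the dimension of
    [g] in [N], which is that of [g] in [M], is at least [k + 1]. *)
Lemma morley_geP (M : closedFieldType) n k (g : GRing.formula M) :
  morley_ge n k g <-> dim_ge n k (fun s => GRing.holds s g).
Proof.
elim: k M g => [|k IHk] M g.
  rewrite dim_ge0 /=; split=> [[x gx]|[s s_n gs]].
    by exists x; rewrite ?size_tuple.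
  by move/eqP: s_n => s_n; exists (Tuple s_n).
split=> [[N [f [h [f_el sub disj dh]]]]|].
  apply: contrapT => ndim.
  have [e deg] := degree_bound n 0 k g.
  suff : (size (iota 0 e.+1) <= e)%N by rewrite size_iota ltnn.
  apply: (deg N f [::] f_el _ _ _ h) => //.
  - by rewrite dim_ge_elementary.
  - exact: iota_uniq.
  - by move=> i _ s /eqP s_n; apply: (sub i (Tuple s_n)).
  - by move=> i j _ _ ne_ij s /eqP s_n; apply: (disj i j ne_ij (Tuple s_n)).
  - by move=> i _; apply/IHk/dh.
move=> /(@dim_ge_disjoint M n k [::])[h [sub disj dh]].
exists M, idfun, h; split.
- exact: elementary_id.
- by move=> i x; rewrite map_formula_id; apply: sub; rewrite size_tuple.
- by move=> i j ne_ij x; apply: disj; rewrite ?size_tuple.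
- by move=> i; apply/IHk.
Qed.

(** Passage from tuples, on which the ranks are defined, to sequences, on which
    the recursive [dim_ge] is. *)
Definition tset (M : Type) n (X : set (n.-tuple M)) (s : seq M) :=
  exists2 t : n.-tuple M, X t & tval t = s.

Definition field_definable (M : closedFieldType) n (X : set (n.-tuple M)) :=
  exists g, defines g X.

Lemma defines_tset (M : closedFieldType) n (X : set (n.-tuple M)) g s :
  defines g X -> size s = n -> tset X s <-> GRing.holds s g.
Proof.
move=> gX /eqP s_n; split=> [[t /gX + <-] //|gs].
by exists (Tuple s_n) => //; apply/gX.
Qed.

Lemma tset_sub (M : eqType) n k (X Y : set (n.-tuple M)) :
  (X `<=` Y)%classic -> dim_ge n k (tset X) -> dim_ge n k (tset Y).
Proof. by move=> XY; apply: dim_ge_sub => s _ [t /XY Yt <-]; exists t. Qed.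

Lemma rank_geP (M : closedFieldType) n (X : set (n.-tuple M)) k :
  field_definable X -> rank_ge X k <-> dim_ge n k (tset X).
Proof.
have dimE g : defines g X -> morley_ge n k g <-> dim_ge n k (tset X).
  move=> gX; rewrite morley_geP; apply: dim_ge_eq => s s_n.
  by apply: iff_sym; apply: defines_tset.
move=> [g gX]; split=> [[h [/dimE hX /hX]] //|dX].
by exists g; split=> //; apply/dimE.
Qed.

(** Determines [mrank X], also when [X] is empty and the rank is [None]. *)
Lemma mrankP (M : closedFieldType) n (X : set (n.-tuple M)) k :
  field_definable X -> dim_ge n k (tset X) <-> rle (Some k) (mrank X).
Proof.
move=> X_def; have dimE j := rank_geP j X_def; rewrite /mrank.
case: asboolP => [/dimE d0|nd0]; last first.
  by split=> // /(dim_ge_le (leq0n k))/dimE.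
have [r [dr ndr]] : ([set k | rank_ge X k /\ ~ rank_ge X k.+1] !=set0)%classic.
  apply: contrapT => none; suff /(_ n.+1)/dim_ge_leq : forall j, dim_ge n j (tset X).
    by rewrite ltnn.
  elim=> // j dj; apply: contrapT => ndj; apply: none; exists j.
  by split; rewrite dimE.
have [] := @xgetPex _ 0%N [set k | rank_ge X k /\ ~ rank_ge X k.+1]%classic.
  by exists r.
move: (xget _ _) => {dr ndr}r /dimE dr; rewrite dimE => ndr /=.
split=> [dk|le_kr]; last exact: dim_ge_le dr.
by rewrite leqNgt; apply/negP => lt_rk; apply/ndr/(dim_ge_le lt_rk).
Qed.

Lemma mrank_definable (M : closedFieldType) n (X : set (n.-tuple M)) r :
  mrank X = Some r -> field_definable X.
Proof. by rewrite /mrank; case: asboolP => // -[g [gX _]] _; exists g. Qed.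

Lemma rank_eq (a b : option nat) :
  (forall k, rle (Some k) a <-> rle (Some k) b) -> a = b.
Proof.
case: a b => [a|] [b|] //= ab.
- by congr Some; apply/eqP; rewrite eqn_leq (ab a).1 ?(ab b).2.
- by have := (ab a).1 (leqnn a).
- by have := (ab b).2 (leqnn b).
Qed.

(** * Morley degree *)

Section Degree.
Variables (M : closedFieldType) (n : nat).
Implicit Types (A B : set (n.-tuple M)) (g : GRing.formula M).

Lemma defines_sub A B g h (N : closedFieldType) (f : M -> N) :
    elementary f -> defines g A -> defines h B -> (A `<=` B)%classic ->
  forall s, size s = n -> GRing.holds s (map_formula f g) ->
    GRing.holds s (map_formula f h).
Proof.
move=> f_el gA hB AB s s_n; apply: (elementary_forall (g := GRing.Implies g h) f_el _ s_n).
move=> s' /eqP s'_n /(proj2 (gA (Tuple s'_n)))/AB; exact: (proj1 (hB _)).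
Qed.

Lemma morley_split_sub A B g h r d :
    defines g A -> defines h B -> (A `<=` B)%classic ->
  morley_split n r d g -> morley_split n r d h.
Proof.
move=> gA hB AB [N [f [u [f_el sub disj ru]]]]; exists N, f, u; split=> // i x ux.
by apply: (defines_sub f_el gA hB AB); rewrite ?size_tuple //; apply: sub ux.
Qed.

Lemma degree_geP A g r d : defines g A -> mrank A = Some r ->
  degree_ge A d <-> morley_split n r d g.
Proof.
move=> gA Ar; split=> [[h [r' [hA]]]|gd]; last by exists g, r.
by rewrite Ar => -[<-]; apply: morley_split_sub hA gA _.
Qed.

(** The degree is a genuine maximum, by [degree_bound]: the default value of
    [xget] does not occur. *)
Lemma mdegreeP A r : mrank A = Some r ->
  degree_ge A (mdegree A) /\ ~ degree_ge A (mdegree A).+1.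
Proof.
move=> Ar; have [g gA] := mrank_definable Ar.
have dimA k : dim_ge n k (tset A) <-> (k <= r)%N.
  by rewrite mrankP ?Ar //; exists g.
apply: (@xgetPex _ 0%N [set d | degree_ge A d /\ ~ degree_ge A d.+1]%classic).
have [e deg] := degree_bound n 0 r g.
apply: contrapT => none; have : degree_ge A e.+1.
  elim: e.+1 => [|d IHd]; last first.
    by apply: contrapT => nd; apply: none; exists d.
  apply/(degree_geP _ gA Ar); exists M, idfun, (fun=> GRing.Bool false).
  by split=> [|i|i|i]; [exact: elementary_id|case: i..].
case/(degree_geP _ gA Ar) => N [f [h [f_el sub disj rh]]].
suff : (size (enum 'I_e.+1) <= e)%N by rewrite size_enum_ord ltnn.
apply: (deg N f [::] f_el _ _ _ h) => //.
- rewrite dim_ge_elementary // -(dim_ge_eq _ (fun s => @defines_tset _ _ _ _ s gA)).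
  by rewrite dimA ltnn.
- exact: enum_uniq.
- by move=> i _ s /eqP s_n; apply: (sub i (Tuple s_n)).
- by move=> i j _ _ ne_ij s /eqP s_n; apply: (disj i j ne_ij (Tuple s_n)).
- by move=> i _; apply/morley_geP.
Qed.

(** If the difference has rank [r], it can be added as a new piece to any
    family of disjoint pieces of [A], so that [B] has larger degree. Otherwise
    a piece of [B] of rank [r] still has rank [r] when cut down to [A]. *)
Lemma mdegree_eqP A B r : (A `<=` B)%classic -> mrank A = Some r ->
    mrank B = Some r ->
  mdegree A = mdegree B <-> ~ dim_ge n r (tset (B `\` A)%classic).
Proof.
move=> AB Ar Br; have [[g gA] [h hB]] := (mrank_definable Ar, mrank_definable Br).
pose diff := GRing.And h (GRing.Not g).
have diffE : defines diff (B `\` A)%classic.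
  by move=> x; split=> -[Bx nAx]; (split; [exact/hB|]); apply: contra_not nAx => /gA.
have diffP (N : closedFieldType) (f : M -> N) : elementary f ->
    dim_ge n r (fun s => GRing.holds s (map_formula f diff)) <->
    dim_ge n r (tset (B `\` A)%classic).
  move=> f_el; rewrite dim_ge_elementary //; apply: iff_sym; apply: dim_ge_eq.
  by move=> s; apply: defines_tset.
split=> [degAB dimBA|ndimBA].
  have [[dA _] [_ []]] := (mdegreeP Ar, mdegreeP Br).
  rewrite -degAB; move: dA => /(degree_geP _ gA Ar)[N [f [u [f_el sub disj ru]]]].
  apply/(degree_geP _ hB Br); exists N, f.
  (* The piece 0 is the difference, the others are those of A. *)
  pose v i := if unlift ord0 i is Some j then u j else map_formula f diff.
  exists v; split=> // [i x|i j|i].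
  - rewrite /v; case: unliftP => [j _ /sub ux|_ []//].
    by apply: (defines_sub f_el gA hB AB); rewrite ?size_tuple.
  - rewrite /v; case: unliftP => [i'|] ->; case: unliftP => [j'|] -> // ne_ij x.
    + by apply: disj => eij; apply: ne_ij; rewrite eij.
    + by case=> /sub gx [_ /(_ gx)].
    + by case=> -[_ ngx] /sub /ngx.
  - rewrite /v; case: unliftP => [j _|_]; first exact: ru.
    by apply/morley_geP/diffP.
rewrite /mdegree; congr (xget _ _); apply/funext => d; apply/propext.
suff dE k : degree_ge A k <-> degree_ge B k by rewrite /= !dE.
rewrite (degree_geP _ gA Ar) (degree_geP _ hB Br).
split; first exact: morley_split_sub gA hB AB.
case=> N [f [u [f_el sub disj ru]]].
exists N, f, (fun i => GRing.And (u i) (map_formula f g)); split=> //.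
- by move=> i x [].
- by move=> i j ne_ij x [[uix _] [ujx _]]; apply: (disj i j ne_ij x).
move=> i; apply/morley_geP.
have : dim_ge n r (fun s => GRing.holds s (GRing.And (u i) (map_formula f g)) \/
    GRing.holds s (map_formula f diff)).
  apply: dim_ge_sub (proj1 (morley_geP _ _ _) (ru i)) => s /eqP s_n us.
  have hs := sub i (Tuple s_n) us.
  by have [gs|ngs] := pselect (GRing.holds s (map_formula f g)); [left|right].
by case/dim_ge_or=> // /(diffP _ _ f_el).
Qed.

End Degree.

(** * Products of definable sets *)

Section TupleSplit.
Variables (T : Type) (k k' : nat).
Implicit Types (c : (k + k').-tuple T) (a : k.-tuple T) (b : k'.-tuple T).

Lemma size_tleft c : size (take k c) == k.
Proof. by rewrite size_takel // size_tuple leq_addr. Qed.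

Lemma size_tright c : size (drop k c) == k'.
Proof. by rewrite size_drop size_tuple addKn. Qed.

Definition tleft c : k.-tuple T := Tuple (size_tleft c).
Definition tright c : k'.-tuple T := Tuple (size_tright c).

Lemma tleft_cat a b : tleft [tuple of a ++ b] = a.
Proof. by apply: val_inj; rewrite /= take_size_cat ?size_tuple. Qed.

Lemma tright_cat a b : tright [tuple of a ++ b] = b.
Proof. by apply: val_inj; rewrite /= drop_size_cat ?size_tuple. Qed.

Lemma cat_tleft_tright c : [tuple of tleft c ++ tright c] = c.
Proof. by apply: val_inj; rewrite /= cat_take_drop. Qed.

Definition tcat a b : (k + k').-tuple T := [tuple of a ++ b].

Lemma tcat_eq a b c : tcat a b = c <-> a = tleft c /\ b = tright c.
Proof.
split=> [<-|[-> ->]]; last exact: cat_tleft_tright.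
by rewrite /tcat tleft_cat tright_cat.
Qed.

Lemma graphE (A : set (k.-tuple T)) (q : k.-tuple T -> k'.-tuple T) c :
  [set [tuple of a ++ q a] | a in A]%classic c <->
  A (tleft c) /\ q (tleft c) = tright c.
Proof.
split=> [[a Aa <-]|[Ac qc]]; first by rewrite tleft_cat tright_cat.
by exists (tleft c); rewrite // qc cat_tleft_tright.
Qed.

Lemma set_prodE (X : set (k.-tuple T)) (X' : set (k'.-tuple T)) c :
  set_prod X X' c <-> X (tleft c) /\ X' (tright c).
Proof.
split=> [[a Xa [b Xb <-]]|[Xa Xb]]; first by rewrite tleft_cat tright_cat.
by exists (tleft c) => //; exists (tright c); rewrite ?cat_tleft_tright.
Qed.

Lemma tset_prod (X : set (k.-tuple T)) (X' : set (k'.-tuple T)) s :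
    size s = (k + k')%N ->
  tset (set_prod X X') s <-> tset X (take k s) /\ tset X' (drop k s).
Proof.
move=> /eqP s_n; split.
  by case=> c /set_prodE[Xl Xr] <-; split; [exists (tleft c)|exists (tright c)].
case=> [[a Xa a_s] [b Xb b_s]]; exists [tuple of a ++ b].
  by rewrite set_prodE tleft_cat tright_cat.
by rewrite /= a_s b_s cat_take_drop.
Qed.

End TupleSplit.

(** Variable [i] of a [k]-ary factor sits at position [skip k k' i] once [k']
    coordinates have been inserted after the first [k] ones. *)
Definition skip k k' i := if (i < k)%N then i else (i + k')%N.

Lemma skip_inj k k' : injective (skip k k').
Proof. by move=> i j; rewrite /skip; case: (ltnP i k) => ?; case: (ltnP j k) => ?; lia. Qed.

Lemma nth_skip (T : Type) (x0 : T) k k' (a b c : seq T) i :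
    size a = k -> size b = k' ->
  nth x0 (a ++ b ++ c) (skip k k' i) = nth x0 (a ++ c) i.
Proof.
move=> <- <-; rewrite /skip !nth_cat; case: (ltnP i (size a)) => [->//|le_ai].
have -> : (i + size b < size a)%N = false by lia.
have -> : (i + size b - size a < size b)%N = false by lia.
by congr nth; lia.
Qed.

Lemma nth_skip0 (T : Type) (x0 : T) k k' (a b : seq T) i :
    size a = k -> size b = k' ->
  nth x0 (a ++ b) (skip k k' i) = nth x0 a i.
Proof. by move=> ak bk'; rewrite -{1}[b]cats0 nth_skip // cats0. Qed.

Lemma nth_shift (T : Type) (x0 : T) k (a b : seq T) i :
  size a = k -> nth x0 (a ++ b) (k + i) = nth x0 b i.
Proof. by move=> <-; rewrite nth_cat addKn ltnNge leq_addr. Qed.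

Section Rename.
Variable r : nat -> nat.
Hypothesis r_inj : injective r.

Lemma nth_set_rename (T : Type) (x0 : T) e e' i x :
    (forall j, nth x0 e' j = nth x0 e (r j)) ->
  forall j, nth x0 (set_nth x0 e' i x) j = nth x0 (set_nth x0 e (r i) x) (r j).
Proof. by move=> ee' j; rewrite !nth_set_nth /= (inj_eq r_inj) ee'. Qed.

Fixpoint term_rename (R : Type) (t : GRing.term R) : GRing.term R :=
  match t with
  | GRing.Var i => GRing.Var R (r i)
  | GRing.Const c => GRing.Const c
  | GRing.NatConst m => GRing.NatConst R m
  | GRing.Add t1 t2 => GRing.Add (term_rename t1) (term_rename t2)
  | GRing.Opp t1 => GRing.Opp (term_rename t1)
  | GRing.NatMul t1 m => GRing.NatMul (term_rename t1) m
  | GRing.Mul t1 t2 => GRing.Mul (term_rename t1) (term_rename t2)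
  | GRing.Inv t1 => GRing.Inv (term_rename t1)
  | GRing.Exp t1 m => GRing.Exp (term_rename t1) m
  end.

Fixpoint formula_rename (R : Type) (g : GRing.formula R) : GRing.formula R :=
  match g with
  | GRing.Bool b => GRing.Bool b
  | GRing.Equal t1 t2 => GRing.Equal (term_rename t1) (term_rename t2)
  | GRing.Unit t => GRing.Unit (term_rename t)
  | GRing.And g1 g2 => GRing.And (formula_rename g1) (formula_rename g2)
  | GRing.Or g1 g2 => GRing.Or (formula_rename g1) (formula_rename g2)
  | GRing.Implies g1 g2 => GRing.Implies (formula_rename g1) (formula_rename g2)
  | GRing.Not g1 => GRing.Not (formula_rename g1)
  | GRing.Exists i g1 => GRing.Exists (r i) (formula_rename g1)
  | GRing.Forall i g1 => GRing.Forall (r i) (formula_rename g1)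
  end.

Lemma holds_rename (R : unitRingType) (e e' : seq R) g :
    (forall j, e'`_j = e`_(r j)) ->
  GRing.holds e (formula_rename g) <-> GRing.holds e' g.
Proof.
have evalE (d d' : seq R) t : (forall j, d'`_j = d`_(r j)) ->
    GRing.eval d (term_rename t) = GRing.eval d' t.
  by move=> dd'; elim: t => //= [t -> u ->|t ->|t -> m|t -> u ->|t ->|t -> m].
elim: g e e' => //= [t u|t|g IHg h IHh|g IHg h IHh|g IHg h IHh|g IHg|i g IHg|i g IHg] e e' ee'.
- by rewrite !(evalE e e').
- by rewrite (evalE e e').
- by rewrite (IHg e e') // (IHh e e').
- by rewrite (IHg e e') // (IHh e e').
- by rewrite (IHg e e') // (IHh e e').
- by rewrite (IHg e e').
- have gE x := IHg _ _ (nth_set_rename i x ee').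
  by split=> -[x /gE gx]; exists x.
- have gE x := IHg _ _ (nth_set_rename i x ee').
  by split=> gx x; apply/gE.
Qed.

End Rename.

(** Addition of ranks, [None] standing for the rank of the empty set. *)
Definition radd (a b : option nat) : option nat :=
  if a is Some i then if b is Some j then Some (i + j)%N else None else None.

Lemma rle_radd k a b : rle (Some k) (radd a b) <->
  exists i j, [/\ k = (i + j)%N, rle (Some i) a & rle (Some j) b].
Proof.
case: a b => [a|] [b|] /=; split=> //; try by case=> i [j []].
  by move=> le_k; exists (minn k a), (k - minn k a)%N; split; lia.
by case=> i [j [-> ? ?]]; apply: leq_add.
Qed.

Section ProductRank.
Variables (M : closedFieldType) (n n' : nat).
Variables (X : set (n.-tuple M)) (X' : set (n'.-tuple M)).
Hypotheses (X_def : field_definable X) (X'_def : field_definable X').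

Lemma field_definable_prod : field_definable (set_prod X X').
Proof.
have [[g gX] [g' gX']] := (X_def, X'_def).
exists (GRing.And (formula_rename (skip n n') g) (formula_rename (addn n) g')).
move=> c; rewrite set_prodE gX gX' /=.
have cE : c = tleft c ++ tright c :> seq M by rewrite /= cat_take_drop.
rewrite (@holds_rename _ (@skip_inj n n') _ c (tleft c)); last first.
  by move=> j; rewrite cE nth_skip0 ?size_tuple.
rewrite (@holds_rename _ (@addnI n) _ c (tright c)) // => j.
by rewrite cE nth_shift ?size_tuple.
Qed.

Lemma mrank_prod : mrank (set_prod X X') = radd (mrank X) (mrank X').
Proof.
apply: rank_eq => k; rewrite rle_radd.
rewrite -mrankP; last exact: field_definable_prod.
rewrite (dim_ge_eq _ (fun s => @tset_prod _ _ _ X X' s)) dim_ge_prod.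
by split=> -[i [j [-> di dj]]]; exists i, j; split=> //; apply/mrankP.
Qed.

End ProductRank.

(** * Finite presentation of Zariski closed sets *)

(** Dickson's lemma, by induction on [n]: take a basis [B] for the tails of the
    elements of [S], and realise each of them with some first coordinate below
    [H]. This takes care of the elements with first coordinate at least [H];
    for each smaller first coordinate there is a basis of its own. *)
Lemma dickson n (S : seq nat -> Prop) :
  exists2 B : seq (seq nat), forall b, b \in B -> size b = n /\ S b
    & forall m, size m = n -> S m -> exists2 b, b \in B & all2 leq b m.
Proof.
elim: n S => [|n IHn] S.
  have [S0|nS0] := pselect (S [::]).
    by exists [:: [::]] => [b|m /size0nil->]; [rewrite inE => /eqP->|exists [::]].
  by exists [::] => // m /size0nil->.
have [B B_S S_B] := IHn (fun s => exists i, S (i :: s)).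
have [H S_H] : exists H, forall b, b \in B -> exists2 i, (i < H)%N & S (i :: b).
  elim: B B_S {S_B} => [|b B IHB] B_S; first by exists 0%N.
  have [|H S_H] := IHB; first by move=> c cB; apply: B_S; rewrite in_cons cB orbT.
  have [_ [i Sib]] := B_S b (mem_head _ _).
  exists (maxn i.+1 H) => c; rewrite in_cons => /orP[/eqP->|/S_H[j lt_jH Sjc]].
    by exists i; rewrite ?leq_maxl.
  by exists j; rewrite // (leq_trans lt_jH) // leq_maxr.
have [C [C_S S_C]] : exists C : seq (seq nat),
    (forall b, b \in C -> size b = n.+1 /\ S b) /\
    forall i m, (i < H)%N -> size m = n -> S (i :: m) ->
      exists2 b, b \in C & all2 leq b (i :: m).
  elim: H {S_H} => [|H [C [C_S S_C]]]; first by exists [::].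
  have [D D_S S_D] := IHn (fun s => S (H :: s)).
  exists (C ++ map (cons H) D); split.
    move=> b; rewrite mem_cat => /orP[/C_S //|/mapP[d /D_S[d_n Sd] ->]].
    by rewrite /= d_n.
  move=> i m; rewrite ltnS leq_eqVlt => /orP[/eqP->|lt_iH] m_n Sim.
    have [d dD dm] := S_D m m_n Sim.
    exists (H :: d); rewrite /= ?leqnn // mem_cat map_f ?orbT //.
  by have [b bC bm] := S_C i m lt_iH m_n Sim; exists b; rewrite // mem_cat bC.
have {S_H} [E [E_S S_E]] : exists E : seq (seq nat),
    (forall b, b \in E -> size b = n.+1 /\ S b) /\
    forall b, b \in B -> exists2 i, (i < H)%N & (i :: b) \in E.
  elim: B B_S S_H {S_B} => [|b B IHB] B_S S_H; first by exists [::].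
  have [||E [E_S S_E]] := IHB.
  - by move=> c cB; apply: B_S; rewrite in_cons cB orbT.
  - by move=> c cB; apply: S_H; rewrite in_cons cB orbT.
  have [i lt_iH Sib] := S_H b (mem_head _ _).
  have [b_n _] := B_S b (mem_head _ _).
  exists ((i :: b) :: E); split.
    by move=> c; rewrite in_cons => /orP[/eqP->|/E_S //]; rewrite /= b_n.
  move=> c; rewrite in_cons => /orP[/eqP->|/S_E[j lt_jH jcE]].
    by exists i; rewrite ?mem_head.
  by exists j; rewrite // in_cons jcE orbT.
exists (C ++ E).
  by move=> b; rewrite mem_cat => /orP[/C_S|/E_S].
move=> [|i m] // [m_n] Sim.
have [b bB bm] := S_B m m_n (ex_intro _ i Sim).
have [j lt_jH jbE] := S_E b bB.
have [lt_iH|le_Hi] := ltnP i H.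
  by have [c cC cm] := S_C i m lt_iH m_n Sim; exists c; rewrite // mem_cat cC.
exists (j :: b); rewrite /= ?mem_cat ?jbE ?orbT // bm andbT.
exact: leq_trans (ltnW lt_jH) le_Hi.
Qed.

Section Zariski.
Variables (K : closedFieldType) (n : nat).
Implicit Types (V W T : set (n.-tuple K)) (P Q : {mpoly K[n]}).

Definition vanishes V P := forall x, V x -> P.@[tnth x] = 0.

(** Choose [G] so that its leading monomials form a basis, in the sense of
    Dickson, of the leading monomials of the polynomials vanishing on [V]. A
    polynomial vanishing on [V] can then be reduced by a multiple of an element
    of [G] to one with a smaller leading monomial. *)
Lemma hilbert_basis V : exists2 G : seq {mpoly K[n]},
    forall Q, Q \in G -> vanishes V Q
  & forall P, vanishes V P -> forall x : n.-tuple K,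
      (forall Q, Q \in G -> Q.@[tnth x] = 0) -> P.@[tnth x] = 0.
Proof.
have [B B_S S_B] := dickson n (fun s => exists P,
  [/\ vanishes V P, P != 0 & tval (multinom_val (mlead P)) = s]).
have [G [G_V B_G]] : exists G : seq {mpoly K[n]},
    (forall Q, Q \in G -> vanishes V Q /\ Q != 0) /\
    forall b, b \in B -> exists2 Q, Q \in G & tval (multinom_val (mlead Q)) = b.
  elim: B B_S {S_B} => [|b B IHB] B_S; first by exists [::].
  have [|G [G_V B_G]] := IHB; first by move=> c cB; apply: B_S; rewrite in_cons cB orbT.
  have [_ [P [VP P0 Pb]]] := B_S b (mem_head _ _).
  exists (P :: G); split.
    by move=> Q; rewrite in_cons => /orP[/eqP->|/G_V].
  move=> c; rewrite in_cons => /orP[/eqP->|/B_G[Q QG Qc]].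
    by exists P; rewrite ?mem_head.
  by exists Q; rewrite // in_cons QG orbT.
exists G => [Q /G_V[]//|P VP x Gx].
suff reduce m Q : mlead Q = m -> vanishes V Q -> Q.@[tnth x] = 0 by exact: reduce VP.
elim/(well_founded_ind (@ltom_wf n)): m Q {P VP} => m IHm P Pm VP.
have [->|P0] := eqVneq P 0; first by rewrite meval0.
have [||b bB] := S_B (tval (multinom_val (mlead P))); first by rewrite size_tuple.
  by exists P.
have [Q QG <-] := B_G b bB; have [VQ Q0] := G_V Q QG.
rewrite all2E => /andP[_ /(all_nthP (0, 0)%N) le_QP].
have {le_QP} le_QP : (mlead Q <= mlead P)%MM.
  apply/mnm_lepP => i; rewrite !(mnm_nth 0%N).
  by have := le_QP i; rewrite size_zip !size_tuple minnn nth_zip ?size_tuple //=; exact.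
pose c := mleadc P / mleadc Q; pose X : {mpoly K[n]} := 'X_[mlead P - mlead Q].
have lead_neq0 (R : {mpoly K[n]}) : R != 0 -> mleadc R != 0 by rewrite mleadc_eq0.
have X1 : mleadc X = 1 by rewrite mcoeffX mleadXm eqxx.
have X0 : X != 0 by rewrite -mleadc_eq0 X1 oner_eq0.
(* D has the leading term of P, so that R is smaller than P. *)
pose D := c *: (X * Q); pose R := P - D.
have Dm : mlead D = mlead P.
  by rewrite mleadZ ?mleadM // ?mleadXm ?submK // mulf_neq0 ?invr_eq0 ?lead_neq0.
have DP : D@_(mlead P) = mleadc P.
  have XQ : (X * Q)@_(mlead P) = mleadc Q.
    rewrite -(submK le_QP) -[(mlead P - mlead Q)%MM](mleadXm K) -/X.
    by rewrite mleadcM X1 mul1r.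
  by rewrite mcoeffZ XQ divfK ?lead_neq0.
have D_x (y : n.-tuple K) : Q.@[tnth y] = 0 -> D.@[tnth y] = 0.
  by move=> Qy; rewrite mevalZ mevalM Qy !mulr0.
rewrite -(subrK D P) -/R mevalD (D_x x (Gx Q QG)) addr0.
have [->|R0] := eqVneq R 0; first by rewrite meval0.
apply: (IHm (mlead R)) => // [|y Vy]; last by rewrite mevalB VP ?D_x ?VQ ?subrr.
rewrite -Pm lt_neqAle; apply/andP; split.
  apply: contra (lead_neq0 R R0) => /eqP->.
  by rewrite mcoeffB DP subrr.
by apply: le_trans (mleadB_le _ _) _; rewrite Dm leUx lexx.
Qed.

Lemma closed_finite V : zariski_closed V -> exists G : seq {mpoly K[n]},
  forall x, V x <-> forall Q, Q \in G -> Q.@[tnth x] = 0.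
Proof.
case=> I ->; set V0 := [set x | _]%classic.
have [G G_V V_G] := hilbert_basis V0; exists G => x; split=> [V0x Q /G_V|Gx P IP].
  exact.
by apply: V_G Gx => y V0y; apply: V0y.
Qed.

Lemma zariski_closureP T x :
  zariski_closure T x <-> forall P, vanishes T P -> P.@[tnth x] = 0.
Proof.
split=> [Tx P TP|Tx V [[I ->] TV] P IP]; last by apply: Tx => y /TV; apply.
apply: (Tx [set y | forall Q, vanishes T Q -> Q.@[tnth y] = 0]%classic) TP.
by split; [exists (vanishes T)|move=> y Ty Q; apply].
Qed.

Lemma zariski_closure_closed T : zariski_closed (zariski_closure T).
Proof. by exists (vanishes T); apply/seteqP; split=> x /zariski_closureP. Qed.

Lemma sub_zariski_closure T : (T `<=` zariski_closure T)%classic.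
Proof. by move=> x Tx V [_]; apply. Qed.

Lemma zariski_closure_sub T V : zariski_closed V -> (T `<=` V)%classic ->
  (zariski_closure T `<=` V)%classic.
Proof. by move=> V_cl TV x; apply. Qed.

Lemma zariski_closure_id V : zariski_closed V -> zariski_closure V = V.
Proof.
move=> V_cl; apply/seteqP; split; [exact: zariski_closure_sub|].
exact: sub_zariski_closure.
Qed.

Lemma zariski_closedU V W : zariski_closed V -> zariski_closed W ->
  zariski_closed (V `|` W)%classic.
Proof.
move=> [I ->] [J ->]; exists [set R | exists P Q, [/\ I P, J Q & R = P * Q]]%classic.
apply/seteqP; split=> [x [Ix|Jx] _ [P [Q [IP JQ ->]]]|x IJx]; rewrite ?mevalM.
- by rewrite (Ix P) // mul0r.
- by rewrite (Jx Q) // mulr0.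
have [Ix|nIx] := pselect (forall P, I P -> P.@[tnth x] = 0); [by left|right=> Q JQ].
apply: contrapT => /eqP Qx; apply: nIx => P IP; apply: contrapT => /eqP Px.
have /eqP := IJx (P * Q) (ex_intro _ P (ex_intro _ Q (And3 IP JQ erefl))).
by rewrite mevalM mulf_eq0 (negPf Px) (negPf Qx).
Qed.

(** Multivariate polynomials as terms: the sum of the monomials, built from
    constants and powers of variables. *)
Definition poly_term P : GRing.term K :=
  foldr (fun (m : 'X_{1..n}) t => GRing.Add (GRing.Mul (GRing.Const P@_m)
     (foldr (fun (i : 'I_n) => GRing.Mul (GRing.Exp (GRing.Var K i) (m i)))
       (GRing.NatConst K 1) (enum 'I_n))) t)
  (GRing.NatConst K 0) (msupp P).

Lemma rterm_poly_term P : GRing.rterm (poly_term P).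
Proof.
rewrite /poly_term; elim: (msupp P) => //= m s ->; rewrite andbT.
by elim: (enum _) => //= i t ->.
Qed.

Lemma eval_poly_term P (x : n.-tuple K) : GRing.eval x (poly_term P) = P.@[tnth x].
Proof.
rewrite mevalE /poly_term; elim: (msupp P) => [|m s IHs] /=.
  by rewrite big_nil.
rewrite big_cons IHs; congr (_ * _ + _); rewrite -[LHS]/(GRing.eval x _) -big_enum /=.
elim: (enum _) => [|i t IHt] /=; first by rewrite big_nil.
by rewrite big_cons IHt (tnth_nth 0).
Qed.

Lemma closed_definable V : zariski_closed V -> field_definable V.
Proof.
move=> /closed_finite[G V_G].
exists (foldr (fun P => GRing.And (GRing.Equal (poly_term P) (GRing.NatConst K 0)))
  (GRing.Bool true) G).
move=> x; rewrite V_G; elim: G {V_G} => [|P G IHG] /=; first by split.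
rewrite -IHG eval_poly_term; split=> [Gx|[Px Gx] Q].
  by split=> [|Q QG]; apply: Gx; rewrite in_cons ?eqxx ?QG ?orbT.
by rewrite in_cons => /orP[/eqP->|/Gx].
Qed.

End Zariski.

(** * Closures of products *)

Section ClosureProduct.
Variables (K : closedFieldType) (n n' : nat).
Implicit Types (P : {mpoly K[n + n']}).

Lemma tnth_cat_split (a : n.-tuple K) (b : n'.-tuple K) i :
  tnth [tuple of a ++ b] i = match split i with inl j => tnth a j | inr j => tnth b j end.
Proof.
rewrite -{1}(splitK i); case: (split i) => j /=; [exact: tnth_lshift|exact: tnth_rshift].
Qed.

Lemma meval_fix_right P (b : n'.-tuple K) : exists Q : {mpoly K[n]},
  forall a : n.-tuple K, Q.@[tnth a] = P.@[tnth [tuple of a ++ b]].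
Proof.
exists (P \mPo
  [tuple match split i with inl j => 'X_j | inr j => (tnth b j)%:MP end | i < n + n']).
move=> a; rewrite comp_mpoly_meval; apply: meval_eq => i.
by rewrite tnth_mktuple tnth_cat_split; case: (split i) => j; rewrite ?mevalXU ?mevalC.
Qed.

Lemma meval_fix_left P (a : n.-tuple K) : exists Q : {mpoly K[n']},
  forall b : n'.-tuple K, Q.@[tnth b] = P.@[tnth [tuple of a ++ b]].
Proof.
exists (P \mPo
  [tuple match split i with inl j => (tnth a j)%:MP | inr j => 'X_j end | i < n + n']).
move=> b; rewrite comp_mpoly_meval; apply: meval_eq => i.
by rewrite tnth_mktuple tnth_cat_split; case: (split i) => j; rewrite ?mevalXU ?mevalC.
Qed.

(** A polynomial vanishing on [T * T'] has, for each [y] in [T'], a section in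
    the first variables that vanishes on [T], hence on its closure; then for
    each [x] in the closure of [T], a section in the last variables that
    vanishes on [T'], hence on its closure. *)
Lemma zariski_closure_prod (T : set (n.-tuple K)) (T' : set (n'.-tuple K)) :
  zariski_closure (set_prod T T') =
  set_prod (zariski_closure T) (zariski_closure T').
Proof.
apply/seteqP; split=> z.
  move=> /zariski_closureP Tz; apply/set_prodE; split; apply/zariski_closureP => P TP.
    have := Tz (P \mPo [tuple 'X_(lshift n' i) | i < n]).
    have evalE (c : (n + n').-tuple K) :
        (P \mPo [tuple 'X_(lshift n' i) | i < n]).@[tnth c] = P.@[tnth (tleft c)].
      rewrite comp_mpoly_meval; apply: meval_eq => i.
      rewrite tnth_mktuple mevalXU -{1}(cat_tleft_tright c); exact: tnth_lshift.
    by rewrite evalE; apply=> c /set_prodE[Tc _]; rewrite evalE TP.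
  have := Tz (P \mPo [tuple 'X_(rshift n i) | i < n']).
  have evalE (c : (n + n').-tuple K) :
      (P \mPo [tuple 'X_(rshift n i) | i < n']).@[tnth c] = P.@[tnth (tright c)].
    rewrite comp_mpoly_meval; apply: meval_eq => i.
    rewrite tnth_mktuple mevalXU -{1}(cat_tleft_tright c); exact: tnth_rshift.
  by rewrite evalE; apply=> c /set_prodE[_ Tc]; rewrite evalE TP.
move=> /set_prodE[/zariski_closureP Tx /zariski_closureP Ty].
apply/zariski_closureP => P TP; rewrite -(cat_tleft_tright z).
have [Q QE] := meval_fix_left P (tleft z); rewrite -QE; apply: Ty => y T'y.
have [R RE] := meval_fix_right P y; rewrite QE -RE; apply: Tx => x Tx'.
by rewrite RE TP // set_prodE tleft_cat tright_cat.
Qed.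

Lemma zariski_closed_prod (V : set (n.-tuple K)) (V' : set (n'.-tuple K)) :
  zariski_closed V -> zariski_closed V' -> zariski_closed (set_prod V V').
Proof.
move=> V_cl V'_cl; rewrite -(zariski_closure_id V_cl) -(zariski_closure_id V'_cl).
by rewrite -zariski_closure_prod; apply: zariski_closure_closed.
Qed.

End ClosureProduct.

(** * Definability in the two-sorted language *)

Section TwoSortedRename.
Variables (F K : closedFieldType) (chi : F -> K).
Variables rF rK : nat -> nat.
Hypotheses (rF_inj : injective rF) (rK_inj : injective rK).

Fixpoint fterm_rename (t : fterm F) : fterm F :=
  match t with
  | FVar i => FVar F (rF i)
  | FCst c => FCst c
  | FAdd t u => FAdd (fterm_rename t) (fterm_rename u)
  | FOpp t => FOpp (fterm_rename t)
  | FMul t u => FMul (fterm_rename t) (fterm_rename u)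
  end.

Fixpoint kterm_rename (t : kterm F K) : kterm F K :=
  match t with
  | KVar i => KVar F K (rK i)
  | KCst c => KCst F c
  | KAdd t u => KAdd (kterm_rename t) (kterm_rename u)
  | KOpp t => KOpp (kterm_rename t)
  | KMul t u => KMul (kterm_rename t) (kterm_rename u)
  | KChi t => KChi K (fterm_rename t)
  end.

Fixpoint lformula_rename (g : lformula F K) : lformula F K :=
  match g with
  | LEqF t u => LEqF K (fterm_rename t) (fterm_rename u)
  | LEqK t u => LEqK (kterm_rename t) (kterm_rename u)
  | LNot g => LNot (lformula_rename g)
  | LAnd g h => LAnd (lformula_rename g) (lformula_rename h)
  | LExF i g => LExF (rF i) (lformula_rename g)
  | LExK i g => LExK (rK i) (lformula_rename g)
  end.

Lemma lholds_rename eF eF' eK eK' g :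
    (forall j, eF'`_j = eF`_(rF j)) -> (forall j, eK'`_j = eK`_(rK j)) ->
  lholds chi eF eK (lformula_rename g) <-> lholds chi eF' eK' g.
Proof.
have fE (d d' : seq F) t : (forall j, d'`_j = d`_(rF j)) ->
    feval d (fterm_rename t) = feval d' t.
  by move=> dd'; elim: t => //= [t -> u ->|t ->|t -> u ->].
have kE dF dF' dK dK' t : (forall j, dF'`_j = dF`_(rF j)) ->
    (forall j, dK'`_j = dK`_(rK j)) ->
    keval chi dF dK (kterm_rename t) = keval chi dF' dK' t.
  move=> dFE dKE; elim: t => //= [t -> u ->|t ->|t -> u ->|t] //.
  by rewrite (fE _ dF').
elim: g eF eF' eK eK' => /= [t u|t u|g IHg|g IHg h IHh|i g IHg|i g IHg] eF eF' eK eK' FE KE.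
- by rewrite !(fE eF eF').
- by rewrite !(kE eF eF' eK eK').
- by rewrite (IHg eF eF' eK eK').
- by rewrite (IHg eF eF' eK eK') // (IHh eF eF' eK eK').
- have gE x := IHg _ _ _ _ (nth_set_rename rF_inj i x FE) KE.
  by split=> -[x /gE gx]; exists x.
- have gE x := IHg _ _ _ _ FE (nth_set_rename rK_inj i x KE).
  by split=> -[x /gE gx]; exists x.
Qed.

End TwoSortedRename.

Section TwoSortedDefinability.
Variables (F K : closedFieldType) (chi : F -> K).

Lemma lholds_prod k k' n n' g g' : exists h,
  forall (a : k.-tuple F) (a' : k'.-tuple F) (x : n.-tuple K) (x' : n'.-tuple K),
    lholds chi (a ++ a') (x ++ x') h <-> lholds chi a x g /\ lholds chi a' x' g'.
Proof.
exists (LAnd (lformula_rename (skip k k') (skip n n') g)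
             (lformula_rename (addn k) (addn n) g')) => a a' x x' /=.
rewrite (@lholds_rename _ _ chi _ _ (@skip_inj k k') (@skip_inj n n') _ a _ x);
  try by move=> j; rewrite nth_skip0 ?size_tuple.
by rewrite (@lholds_rename _ _ chi _ _ (@addnI k) (@addnI n) _ a' _ x') // => j;
  rewrite nth_shift ?size_tuple.
Qed.

Lemma definableF_prod k k' (D : set (k.-tuple F)) (D' : set (k'.-tuple F)) :
  definableF chi D -> definableF chi D' -> definableF chi (set_prod D D').
Proof.
move=> [g gD] [g' gD']; have [h hE] := lholds_prod k k' 0 0 g g'.
exists h => c; rewrite set_prodE gD gD'.
by rewrite -(hE _ _ [tuple] [tuple]) /= cat_take_drop.
Qed.

Lemma definable_prod k k' n n' (A : k.-tuple F -> set (n.-tuple K))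
    (A' : k'.-tuple F -> set (n'.-tuple K)) :
  definable chi A -> definable chi A' ->
  definable chi (fun c => set_prod (A (tleft c)) (A' (tright c))).
Proof.
move=> [g gA] [g' gA']; have [h hE] := lholds_prod k k' n n' g g'.
by exists h => c z; rewrite set_prodE gA gA' -hE /= !cat_take_drop.
Qed.

Lemma definable_and k n (D : set (k.-tuple F)) (V : set (n.-tuple K)) :
  definableF chi D -> definableK chi V ->
  definable chi (fun a => [set x | D a /\ V x]%classic).
Proof.
move=> [g gD] [g' gV]; have [h hE] := lholds_prod k 0 0 n g g'.
exists h => a x; rewrite -[(a : seq F)]cats0 -[(x : seq K)]cat0s.
by rewrite (hE _ [tuple] [tuple]) /= -gD -gV.
Qed.

Lemma definable_or k n (A B : k.-tuple F -> set (n.-tuple K)) :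
  definable chi A -> definable chi B ->
  definable chi (fun a => A a `|` B a)%classic.
Proof.
move=> [g gA] [h hB]; exists (LNot (LAnd (LNot g) (LNot h))) => a x /=.
rewrite gA hB; split=> [[?|?] []//|nn].
by have [ga|nga] := pselect (lholds chi a x g); [left|right; apply: contrapT => nh; apply: nn].
Qed.

Lemma definable_eq k n (A B : k.-tuple F -> set (n.-tuple K)) :
  (forall a x, A a x <-> B a x) -> definable chi A -> definable chi B.
Proof. by move=> AB [g gA]; exists g => a x; rewrite -AB. Qed.

Fixpoint kterm_of_term (t : GRing.term K) : kterm F K :=
  match t with
  | GRing.Var i => KVar F K i
  | GRing.Const c => KCst F c
  | GRing.NatConst m => KCst F m%:R
  | GRing.Add t u => KAdd (kterm_of_term t) (kterm_of_term u)
  | GRing.Opp t => KOpp (kterm_of_term t)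
  | GRing.NatMul t m => KMul (kterm_of_term t) (KCst F m%:R)
  | GRing.Mul t u => KMul (kterm_of_term t) (kterm_of_term u)
  | GRing.Inv t => KCst F 0
  | GRing.Exp t m => iter m (KMul (kterm_of_term t)) (KCst F 1)
  end.

Lemma keval_kterm_of_term eF eK t : GRing.rterm t ->
  keval chi eF eK (kterm_of_term t) = GRing.eval eK t.
Proof.
elim: t => //= [t IHt u IHu /andP[rt ru]|t IHt rt|t IHt m rt
  |t IHt u IHu /andP[rt ru]|t IHt m rt].
- by rewrite IHt ?IHu.
- by rewrite IHt.
- by rewrite IHt // mulr_natr.
- by rewrite IHt ?IHu.
- by elim: m => //= m ->; rewrite exprS IHt.
Qed.

Lemma closed_definableK n (V : set (n.-tuple K)) :
  zariski_closed V -> definableK chi V.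
Proof.
move=> /closed_finite[G V_G].
exists (foldr (fun P => LAnd (LEqK (kterm_of_term (poly_term P)) (KCst F 0)))
  (LEqK (KCst F 0) (KCst F 0)) G).
move=> x; rewrite V_G; elim: G {V_G} => [|P G IHG] /=; first by split.
rewrite -IHG keval_kterm_of_term ?rterm_poly_term // eval_poly_term.
split=> [Gx|[Px Gx] Q].
  by split=> [|Q QG]; apply: Gx; rewrite in_cons ?eqxx ?QG ?orbT.
by rewrite in_cons => /orP[/eqP->|/Gx].
Qed.

(** The empty set is also the union of the family consisting of one empty set.
    Nonempty index sets are needed when such unions are combined over a product
    of index sets. *)
Lemma alg_presentable_inhabited n (S : set (n.-tuple K)) : alg_presentable chi S ->
  exists k (D : set (k.-tuple F)) (V : k.-tuple F -> set (n.-tuple K)),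
    [/\ definable_family chi D V, forall a, D a -> zariski_closed (V a),
        S = (\bigcup_(a in D) V a)%classic & exists a, D a].
Proof.
case=> k [D [V [DV_def V_cl SE]]].
have [[a Da]|nD] := pselect (exists a, D a); first by exists k, D, V; split=> //; exists a.
have S0 : S = set0.
  by apply/seteqP; split=> // x; rewrite SE => -[a Da]; case: nD; exists a.
exists 0%N, setT, (fun=> set0); split.
- split; first by exists (LEqF K (FCst 0) (FCst 0)).
  by exists (LNot (LEqF K (FCst 0) (FCst 0))) => a x /=; split=> [[]|].
- move=> _ _; exists [set 1]%classic; apply/seteqP; split=> // x /(_ 1 erefl).
  by rewrite meval1 => /eqP; rewrite oner_eq0.
- by rewrite S0; apply/seteqP; split=> // x [].
- by exists [tuple].
Qed.

(** [(V \ S) * (V' \ S')] is [V * V'] minus [S * V'] and [V * S'], and these two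
    are presented together by the sets [W_a * V'] union [V * W'_b]. *)
Lemma pc_set_prod n n' (T : set (n.-tuple K)) (T' : set (n'.-tuple K)) :
  pc_set chi T -> pc_set chi T' -> pc_set chi (set_prod T T').
Proof.
case=> V [S [V_cl /alg_presentable_inhabited S_pres ->]].
case=> V' [S' [V'_cl /alg_presentable_inhabited S'_pres ->]].
case: S_pres => k [D [W [[D_def W_def] W_cl SE [a0 Da0]]]].
case: S'_pres => k' [D' [W' [[D'_def W'_def] W'_cl S'E [b0 Db0]]]].
pose U (c : (k + k').-tuple F) :=
  (set_prod (W (tleft c)) V' `|` set_prod V (W' (tright c)))%classic.
exists (set_prod V V'), (\bigcup_(c in set_prod D D') U c)%classic; split.
- exact: zariski_closed_prod.
- exists (k + k')%N, (set_prod D D'), U; split=> //; last first.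
    move=> c /set_prodE[Dl Dr]; apply: zariski_closedU; apply: zariski_closed_prod => //.
      exact: W_cl.
    exact: W'_cl.
  split; first exact: definableF_prod.
  apply: definable_eq (definable_or
    (definable_prod W_def (definable_and D'_def (closed_definableK V'_cl)))
    (definable_prod (definable_and D_def (closed_definableK V_cl)) W'_def)).
  by move=> c z; rewrite /= /U /setU /= !set_prodE /=; tauto.
apply/seteqP; split=> z; rewrite /setD /= !set_prodE.
  move=> [[Vl nSl] [Vr nSr]]; split=> // -[c /set_prodE[Dl Dr]].
  case=> /set_prodE[Wl Wr]; [apply: nSl; rewrite SE|apply: nSr; rewrite S'E].
    by exists (tleft c).
  by exists (tright c).
move=> [[Vl Vr] nS]; split; split=> // Sz; apply: nS.
  move: Sz; rewrite SE => -[a Da Wa]; exists [tuple of a ++ b0].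
    by rewrite set_prodE tleft_cat tright_cat.
  by left; rewrite set_prodE tleft_cat.
move: Sz; rewrite S'E => -[b Db Wb]; exists [tuple of a0 ++ b].
  by rewrite set_prodE tleft_cat tright_cat.
by right; rewrite set_prodE tright_cat.
Qed.

(** The coordinates of [c] are grouped as [((a, a'), (b, b'))], the arguments
    of both functions preceding the values, as in the graph of [q * q']. *)
Lemma definableF_graph_prod k l k' l' (G : set ((k + l).-tuple F))
    (G' : set ((k' + l').-tuple F)) :
    definableF chi G -> definableF chi G' ->
  definableF chi [set c : ((k + k') + (l + l')).-tuple F |
    G (tcat (tleft (tleft c)) (tleft (tright c))) /\
    G' (tcat (tright (tleft c)) (tright (tright c)))]%classic.
Proof.
move=> [g gG] [g' gG'].
exists (LAnd (lformula_rename (skip k k' \o skip (k + l) l') id g)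
             (lformula_rename (addn k \o skip k' l) id g')) => c.
rewrite /= gG gG'.
pose a := tleft (tleft c); pose a' := tright (tleft c).
pose b := tleft (tright c); pose b' := tright (tright c).
have cE : c = a ++ a' ++ b ++ b' :> seq F.
  by rewrite /= catA !cat_take_drop.
have abE j : (a ++ b)`_j = c`_(skip k k' (skip (k + l) l' j)).
  by rewrite cE nth_skip ?catA ?nth_skip0 ?size_cat ?size_tuple.
have abE' j : (a' ++ b')`_j = c`_(k + skip k' l j).
  by rewrite cE nth_shift ?nth_skip ?size_tuple.
rewrite (@lholds_rename _ _ chi _ id _ _ c (a ++ b) [::] [::]) //; last first.
  by apply: inj_comp; apply: skip_inj.
rewrite (@lholds_rename _ _ chi _ id _ _ c (a' ++ b') [::] [::]) //.
by apply: inj_comp; [apply: addnI|apply: skip_inj].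
Qed.

End TwoSortedDefinability.

(** * Rank and degree of products of pc-sets *)

Lemma rle_anti a b : rle a b -> rle b a -> a = b.
Proof.
by case: a b => [a|] [b|] //= ab ba; congr Some; apply/eqP; rewrite eqn_leq ab.
Qed.

Lemma rle_radd2 a b c d : rle a c -> rle b d -> rle (radd a b) (radd c d).
Proof. by case: a b c d => [a|] [b|] [c|] [d|] //=; apply: leq_add. Qed.

(** A sum of ranks is maximal only if both of its terms are. *)
Lemma radd_eq a b r r' : rle a (Some r) -> rle b (Some r') ->
  radd a b = Some (r + r')%N <-> a = Some r /\ b = Some r'.
Proof.
case: a b => [a|] [b|] //= ar br; try by split=> // -[].
by split=> [[ab]|[[->] [->]] //]; split; congr Some; lia.
Qed.

Lemma rlt_irrefl a : rlt a a = false.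
Proof. by case: a => [a|]; rewrite /rlt //= leqnn. Qed.

Section Ranks.
Variable K : closedFieldType.

Lemma closure_definable n (T : set (n.-tuple K)) :
  field_definable (zariski_closure T).
Proof. exact/closed_definable/zariski_closure_closed. Qed.

Lemma rKP n (T : set (n.-tuple K)) k :
  dim_ge n k (tset (zariski_closure T)) <-> rle (Some k) (rK T).
Proof. exact/mrankP/closure_definable. Qed.

Lemma zariski_closure_mono n (T U : set (n.-tuple K)) :
  (T `<=` U)%classic -> (zariski_closure T `<=` zariski_closure U)%classic.
Proof.
move=> TU; apply: zariski_closure_sub; first exact: zariski_closure_closed.
by move=> x /TU; apply: sub_zariski_closure.
Qed.

Lemma rK_mono n (T U : set (n.-tuple K)) : (T `<=` U)%classic -> rle (rK T) (rK U).
Proof.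
move=> /zariski_closure_mono TU; case rT: (rK T) => [r|] //.
by apply/rKP; apply: tset_sub TU _; apply/rKP; rewrite rT /=.
Qed.

Lemma dK_eqP n (A B : set (n.-tuple K)) r : (A `<=` B)%classic ->
    rK A = Some r -> rK B = Some r ->
  dK A = dK B <-> ~ dim_ge n r (tset (zariski_closure B `\` zariski_closure A)%classic).
Proof. by move=> /zariski_closure_mono AB Ar Br; apply: mdegree_eqP. Qed.

Variables n n' : nat.

Lemma rK_prod (T : set (n.-tuple K)) (T' : set (n'.-tuple K)) :
  rK (set_prod T T') = radd (rK T) (rK T').
Proof.
by rewrite /rK zariski_closure_prod mrank_prod //; apply: closure_definable.
Qed.

Lemma set_prodI (T U : set (n.-tuple K)) (T' U' : set (n'.-tuple K)) :
  (set_prod T T' `&` set_prod U U' = set_prod (T `&` U) (T' `&` U'))%classic.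
Proof.
by apply/seteqP; split=> z; rewrite /setI /= !set_prodE /=; tauto.
Qed.

(** By [dK_eqP] equality of degrees means that the difference of the closures
    has smaller rank. The difference of the products lies in the union of
    [(E \ C) * E'] and [E * (E' \ C')], whose ranks are below [r + r']. *)
Lemma dK_prod_sub (A B : set (n.-tuple K)) (A' B' : set (n'.-tuple K)) r r' :
    (A `<=` B)%classic -> (A' `<=` B')%classic ->
    rK A = Some r -> rK B = Some r -> rK A' = Some r' -> rK B' = Some r' ->
    dK A = dK B -> dK A' = dK B' ->
  dK (set_prod A A') = dK (set_prod B B').
Proof.
move=> AB AB' Ar Br Ar' Br' /(dK_eqP AB Ar Br) nd /(dK_eqP AB' Ar' Br') nd'.
have ABprod : (set_prod A A' `<=` set_prod B B')%classic.
  by move=> z /set_prodE[Al Ar'']; apply/set_prodE; split; [exact: AB|exact: AB'].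
apply/(dK_eqP (r := (r + r')%N) ABprod); rewrite ?rK_prod ?Ar ?Ar' ?Br ?Br' //.
rewrite !zariski_closure_prod.
set C := zariski_closure A in nd *; set C' := zariski_closure A' in nd' *.
set E := zariski_closure B in nd *; set E' := zariski_closure B' in nd' *.
have dE k : dim_ge n k (tset E) -> (k <= r)%N by move/rKP; rewrite Br.
have dE' k : dim_ge n' k (tset E') -> (k <= r')%N by move/rKP; rewrite Br'.
pose L := set_prod (E `\` C)%classic E'; pose R := set_prod E (E' `\` C')%classic.
move=> d; have : dim_ge (n + n') (r + r') (fun s => tset L s \/ tset R s).
  apply: dim_ge_sub d => s _ [z [Ez nCz] <-].
  have [Cl|nCl] := pselect (C (tleft z)).
    right; exists z => //; move: Ez => /set_prodE[El Er]; apply/set_prodE.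
    by split=> //; split=> // Cr; apply: nCz; apply/set_prodE.
  left; exists z => //; move: Ez => /set_prodE[El Er]; apply/set_prodE.
  by split.
case/dim_ge_or.
  rewrite (dim_ge_eq _ (fun s => @tset_prod _ _ _ _ _ s)) dim_ge_prod.
  case=> i [j [rr dL /dE' le_j]]; apply: nd; apply: dim_ge_le dL; lia.
rewrite (dim_ge_eq _ (fun s => @tset_prod _ _ _ _ _ s)) dim_ge_prod.
case=> i [j [rr /dE le_i dR]]; apply: nd'; apply: dim_ge_le dR; lia.
Qed.

(** Both products have the rank and degree of the product of the
    intersections, which is the intersection of the products. *)
Lemma almost_equal_prod (T U : set (n.-tuple K)) (T' U' : set (n'.-tuple K)) r r' :
    rK T = Some r -> rK T' = Some r' ->
    almost_equal T U -> almost_equal T' U' ->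
  almost_equal (set_prod T T') (set_prod U U').
Proof.
move=> Tr Tr' [TU UI dTU dUI] [TU' UI' dTU' dUI'].
have Ur : rK U = Some r by rewrite -TU.
have Ur' : rK U' = Some r' by rewrite -TU'.
have Ir : rK (T `&` U)%classic = Some r by rewrite -UI.
have Ir' : rK (T' `&` U')%classic = Some r' by rewrite -UI'.
have dIU : dK (set_prod (T `&` U) (T' `&` U'))%classic = dK (set_prod U U').
  by apply: (dK_prod_sub (r := r) (r' := r')) => //.
have dIT : dK (set_prod (T `&` U) (T' `&` U'))%classic = dK (set_prod T T').
  apply: (dK_prod_sub (r := r) (r' := r')) => //.
  - by rewrite -dUI.
  - by rewrite -dUI'.
by split; rewrite ?set_prodI ?rK_prod ?dIU ?TU ?UI ?TU' ?UI' -?dIT.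
Qed.

Lemma almost_disjoint_prod (T U : set (n.-tuple K)) (T' U' : set (n'.-tuple K)) r r' :
    rK T = Some r -> rK U = Some r -> rK T' = Some r' -> rK U' = Some r' ->
    almost_disjoint T U \/ almost_disjoint T' U' ->
  almost_disjoint (set_prod T T') (set_prod U U').
Proof.
move=> Tr Ur Tr' Ur' disj; split; first by rewrite !rK_prod Tr Ur Tr' Ur'.
rewrite set_prodI !rK_prod Tr Tr'.
have := rK_mono (@subIsetl _ T U); have := rK_mono (@subIsetl _ T' U').
rewrite Tr Tr'; case: disj => -[_]; rewrite ?Tr ?Tr' /rlt.
  by case: (rK _) => [i|]; case: (rK _) => [j|] //=; lia.
by case: (rK _) => [i|]; case: (rK _) => [j|] //=; lia.
Qed.

Lemma almost_equal_not_disjoint m (T U : set (m.-tuple K)) :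
  almost_equal T U -> ~ almost_disjoint T U.
Proof. by case=> TU UI _ _ [_]; rewrite -UI -TU rlt_irrefl. Qed.

End Ranks.

(** * The product presentation *)

Section PrimaryIndices.
Variables (F K : closedFieldType).

Lemma primary_index_setP n k (D : set (k.-tuple F)) (T : k.-tuple F -> set (n.-tuple K)) r a :
  max_rank D T r -> primary_index_set D T a <-> D a /\ rK (T a) = r.
Proof.
move=> [[b Db Tbr] max_r]; split=> [[Da [_ max_a]]|[Da Tar]].
  split=> //; apply: rle_anti (max_r a Da) _; rewrite -Tbr; exact: max_a.
by split=> //; split; [exists a|rewrite Tar].
Qed.

End PrimaryIndices.

Theorem proposition1p10 (p : nat) (hp : prime p \/ p = 0%N)
  (F K : closedFieldType) (chi : F -> K) (hM : ACFC_model p chi)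
  (n n' : nat) (X : set (n.-tuple K)) (X' : set (n'.-tuple K))
  (hX : definableK chi X) (hX' : definableK chi X')
  (rhoK rhoF rhoK' rhoF' : nat)
  (hgr : has_gr chi X (Some (rhoK, rhoF)))
  (hgr' : has_gr chi X' (Some (rhoK', rhoF'))) :
  has_gr chi (set_prod X X') (Some ((rhoK + rhoK')%N, (rhoF + rhoF')%N)).
Proof.
case: hgr => k [D [T [l [E [q [[[D_def T_def] T_pc XE] T_disj Q maxT rankE]]]]]].
case: hgr' => k' [D' [T' [l' [E' [q' [[[D'_def T'_def] T'_pc X'E] T'_disj Q' maxT' rankE']]]]]].
case: Q => E_def q_def qE qT; case: Q' => E'_def q'_def q'E q'T.
pose DD := set_prod D D'.
pose TT (c : (k + k').-tuple F) := set_prod (T (tleft c)) (T' (tright c)).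
pose qq (c : (k + k').-tuple F) := [tuple of q (tleft c) ++ q' (tright c)].
have TTr c : rK (TT c) = radd (rK (T (tleft c))) (rK (T' (tright c))).
  exact: rK_prod.
have maxTT : max_rank DD TT (Some (rhoK + rhoK')%N).
  have [[[a Da Ta] max_r] [[b Db Tb] max_r']] := (maxT, maxT'); split.
    exists [tuple of a ++ b]; first by rewrite /DD set_prodE tleft_cat tright_cat.
    by rewrite TTr tleft_cat tright_cat Ta Tb.
  move=> c /set_prodE[Dl Dr]; rewrite TTr.
  exact: rle_radd2 (max_r _ Dl) (max_r' _ Dr).
have primary c : primary_index_set DD TT c <->
    primary_index_set D T (tleft c) /\ primary_index_set D' T' (tright c).
  rewrite (primary_index_setP _ maxTT) (primary_index_setP _ maxT).
  rewrite (primary_index_setP _ maxT') TTr /DD set_prodE.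
  split=> [[[Dl Dr]]|[[Dl Tl] [Dr Tr]]]; last by rewrite Tl Tr.
  by move/(radd_eq (maxT.2 _ Dl) (maxT'.2 _ Dr)) => [].
have rank_primary a : primary_index_set D T a -> rK (T a) = Some rhoK.
  by move/(primary_index_setP _ maxT) => [].
have rank_primary' a : primary_index_set D' T' a -> rK (T' a) = Some rhoK'.
  by move/(primary_index_setP _ maxT') => [].
(* The dichotomy for the factors gives the one for the products, and shows
   that almost equality of the products is almost equality of both factors. *)
have almost_equalE c d : primary_index_set DD TT c -> primary_index_set DD TT d ->
    [/\ almost_equal (TT c) (TT d), almost_equal (T (tleft c)) (T (tleft d))
      & almost_equal (T' (tright c)) (T' (tright d))] \/
    almost_disjoint (TT c) (TT d) /\
    ~ (almost_equal (T (tleft c)) (T (tleft d)) /\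
       almost_equal (T' (tright c)) (T' (tright d))).
  move=> /primary[cl cr] /primary[dl dr].
  have [rcl rcr] := (rank_primary _ cl, rank_primary' _ cr).
  have [rdl rdr] := (rank_primary _ dl, rank_primary' _ dr).
  have [eql|disl] := T_disj _ _ cl dl; last first.
    right; split; first by apply: almost_disjoint_prod rcl rdl rcr rdr _; left.
    by case=> /almost_equal_not_disjoint.
  have [eqr|disr] := T'_disj _ _ cr dr; last first.
    right; split; first by apply: almost_disjoint_prod rcl rdl rcr rdr _; right.
    by case=> _ /almost_equal_not_disjoint.
  by left; split=> //; apply: almost_equal_prod rcl rcr eql eqr.
exists (k + k')%N, DD, TT, (l + l')%N, (set_prod E E'), qq; split.
- split.
  + split; first exact: definableF_prod.
    apply: definable_eq (definable_prod T_def T'_def) => c z.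
    by rewrite /= /DD /TT !set_prodE /=; tauto.
  + by move=> c /set_prodE[Dl Dr]; apply: pc_set_prod; auto.
  + apply/seteqP; split=> z.
      move/set_prodE; rewrite XE X'E => -[[a Da Ta] [b Db Tb]].
      exists [tuple of a ++ b]; first by rewrite /DD set_prodE tleft_cat tright_cat.
      by rewrite /TT set_prodE tleft_cat tright_cat.
    case=> c /set_prodE[Dl Dr] /set_prodE[Tl Tr]; rewrite XE X'E; apply/set_prodE.
    by split; [exists (tleft c)|exists (tright c)].
- by move=> c d cP dP; case: (almost_equalE c d cP dP) => [[]|[]]; [left|right].
- split.
  + exact: definableF_prod.
  + have [g gG] := definableF_graph_prod q_def q'_def; exists g => c; rewrite -gG.
    rewrite graphE /mkset !graphE /tcat !tleft_cat !tright_cat primary.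
    by rewrite -/(tcat _ _) tcat_eq; tauto.
  + apply/seteqP; split=> z.
      case=> c /primary[cl cr] <-; rewrite -qE -q'E set_prodE tleft_cat tright_cat.
      by split; [exists (tleft c)|exists (tright c)].
    rewrite set_prodE -qE -q'E => -[[a aP az] [b bP bz]].
    exists [tuple of a ++ b]; first by apply/primary; rewrite tleft_cat tright_cat.
    by rewrite /qq tleft_cat tright_cat az bz cat_tleft_tright.
  + move=> c d cP dP.
    have [cl cr] := (primary c).1 cP; have [dl dr] := (primary d).1 dP.
    have -> : qq c = qq d <-> q (tleft c) = q (tleft d) /\ q' (tright c) = q' (tright d).
      by rewrite tcat_eq tleft_cat tright_cat.
    rewrite (qT _ _ cl dl) (q'T _ _ cr dr).
    case: (almost_equalE c d cP dP) => [[]|[dis ndis]]; first by split.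
    by split=> [//|/almost_equal_not_disjoint].
- exact: maxTT.
- have [E_fd E'_fd] := (mrank_definable rankE, mrank_definable rankE').
  by rewrite mrank_prod // rankE rankE'.
Qed.
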